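(* Let $r,p,c,n$ satisfy $r\geq2$ (integer), $p>1$, $0<c\leq r^{-(r+8)r}/2$, and $\log n\geq 2p/(cp-c)$. If $G$ is a graph of order $n$ with $\lambda^{(p)}(G)>\lambda^{(p)}(T_r(n))$, then $G$ contains a (not necessarily induced) subgraph isomorphic to $K_r^+(\lfloor c\log n\rfloor)$.
   Context: $\log$ denotes the natural logarithm. For a graph $G$ with vertex set $\{1,\dots,n\}$ and real $p\geq1$, the $p$-spectral radius is $\lambda^{(p)}(G)=\max\{2\sum_{\{i,j\}\in E(G)}x_ix_j : x_1,\dots,x_n\in\mathbb{R},\ |x_1|^p+\cdots+|x_n|^p=1\}$. $T_r(n)$ is the complete $r$-partite graph of order $n$ whose parts have sizes $\lfloor n/r\rfloor$ or $\lceil n/r\rceil$. For integers $r\geq2$, $t\geq1$, $K_r^+(t)$ denotes the complete $r$-partite graph with each part of size $t$, with one edge added inside its first part. *)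

(* Defs.v *)
From HB Require Import structures.
From mathcomp Require Import all_boot all_order all_algebra.
From mathcomp Require Import all_classical all_reals all_analysis.
From mathcomp Require Import zify.

Set Implicit Arguments.
Unset Strict Implicit.
Unset Printing Implicit Defensive.

Import Order.TTheory GRing.Theory Num.Theory.
Import numFieldNormedType.Exports.

Local Open Scope classical_set_scope.
Local Open Scope ring_scope.

Record sgraph (T : finType) := SGraph {
  adj :> rel T;
  adj_sym : symmetric adj;
  adj_irrefl : irreflexive adj }.

(* H has a copy in G as a subgraph, not necessarily an induced one. *)
Definition contains (S T : finType) (G : sgraph T) (H : sgraph S) : Prop :=
  exists2 f : S -> T, injective f & forall u v, H u v -> G (f u) (f v).

(* Each edge {i, j} is counted once, as the pair with i < j. *)
Definition edge_form (R : realType) (n : nat) (G : sgraph 'I_n)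
    (x : 'rV[R]_n) : R :=
  2 * \sum_(i < n) \sum_(j < n | (i < j)%N && G i j) x 0 i * x 0 j.

Definition psphere (R : realType) (n : nat) (p : R) : set 'rV[R]_n :=
  [set x | \sum_(i < n) `|x 0 i| `^ p = 1].

(* The supremum is a maximum for n > 0 and p > 0: see pspectral_radius_max. *)
Definition pspectral_radius (R : realType) (n : nat) (p : R)
    (G : sgraph 'I_n) : R :=
  sup [set edge_form G x | x in psphere p].

Section pspectral_radius_max.
Variable R : realType.

Let continuous_norm_powR (p : R) : 0 < p ->
  continuous (fun t : R => `|t| `^ p).
Proof.
move=> p0 t; have [->|t0] := eqVneq t 0.
  rewrite /continuous_at normr0 powR0 ?gt_eqF//.
  apply/cvgrPdist_lt => e e0.
  have := @nbhs0_lt _ R _ (powR_gt0 p^-1 e0).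
  apply: filterS => u ue.
  rewrite sub0r normrN ger0_norm ?powR_ge0//.
  rewrite -[ltRHS]powRr1 ?ltW// -(mulVf (lt0r_neq0 p0)) powRrM.
  by rewrite gt0_ltr_powR// ?nnegrE ?powR_ge0 ?normr_ge0.
apply: (@continuous_comp R R R (fun u => `|u|) (fun u => u `^ p)).
  exact: norm_continuous.
apply: differentiable_continuous; apply/derivable1_diffP.
by apply: derivable_powR; rewrite in_itv/= andbT normr_gt0.
Qed.

Let continuous_sum (T : topologicalType) (I : finType) (P : pred I)
    (F : I -> T -> R) : (forall i, P i -> continuous (F i)) ->
  continuous (fun x => \sum_(i | P i) F i x).
Proof. by move=> cF; apply: continuous_big => //; exact: add_continuous. Qed.

Let compact_psphere (n : nat) (p : R) : 0 < p -> compact (@psphere R n p).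
Proof.
move=> p0.
have cube : compact [set x : 'rV[R]_n | forall i, `[-1, 1]%classic (x ord0 i)].
  apply: (@rV_compact R n (fun=> `[-1, 1]%classic)) => i.
  exact: segment_compact.
apply: subclosed_compact cube _.
  apply: (@preimage_closed _ _ (fun x : 'rV[R]_n => \sum_i `|x 0 i| `^ p)
    [set y | y = 1]); last exact: closed_eq.
  move=> x0 _; apply: continuous_sum x0 => i _ x.
  apply: (@continuous_comp _ _ _ (fun x : 'rV[R]_n => x 0 i)
    (fun t => `|t| `^ p)).
    exact: coord_continuous.
  exact: continuous_norm_powR.
move=> x xp i; rewrite /= in_itv/= -ler_norml.
rewrite leNgt; apply/negP => xi.
have : 1 `^ p < `|x 0 i| `^ p by rewrite gt0_ltr_powR// nnegrE.
rewrite powR1 -[X in X < _]xp (bigD1 i)//= ltNge lerDl.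
by rewrite sumr_ge0// => j _; exact: powR_ge0.
Qed.

Lemma pspectral_radius_max (n : nat) (p : R) (G : sgraph 'I_n) :
  (0 < n)%N -> 0 < p ->
  exists2 x, psphere p x & edge_form G x = pspectral_radius p G /\
    forall y, psphere p y -> edge_form G y <= edge_form G x.
Proof.
case: n G => // n G _ p0.
have S0 : @psphere R n.+1 p !=set0.
  exists (delta_mx 0 0); rewrite /psphere /= (bigD1 0)//= mxE !eqxx normr1 powR1.
  rewrite big1 ?addr0// => i i0.
  by rewrite mxE (negbTE i0) andbF normr0 powR0// gt_eqF.
have cG : continuous (@edge_form R n.+1 G).
  pose S (x : 'rV[R]_n.+1) :=
    \sum_(i < n.+1) \sum_(j < n.+1 | (i < j)%N && G i j) x 0 i * x 0 j.
  have cS : continuous S.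
    apply: continuous_sum => i _; apply: continuous_sum => j _ x.
    by apply: continuousM; exact: coord_continuous.
  have -> : @edge_form R n.+1 G = (fun=> 2) \* S by [].
  by move=> x; apply: continuousM; [exact: cst_continuous | exact: cS].
have [x xS xmax] := EVT_max_rV S0 (compact_psphere p0)
  (continuous_subspaceT cG).
rewrite inE in xS.
have {}xmax y : psphere p y -> edge_form G y <= edge_form G x.
  by move=> yS; apply: xmax; rewrite inE.
exists x => //; split=> //; apply/eqP; rewrite eq_le; apply/andP; split.
  apply: ub_le_sup; last by exists x.
  by exists (edge_form G x) => _ [y yS <-]; exact: xmax.
apply: ge_sup; first by exists (edge_form G x), x.
by move=> _ [y yS <-]; exact: xmax.
Qed.

End pspectral_radius_max.

(* The parts are the residue classes mod r, whose sizes are balanced by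
   card_turan_part. *)
Definition turan_adj (r n : nat) : rel 'I_n :=
  fun i j => (i %% r != j %% r)%N.

Lemma turan_adj_sym r n : symmetric (@turan_adj r n).
Proof. by move=> i j; rewrite /turan_adj eq_sym. Qed.

Lemma turan_adj_irrefl r n : irreflexive (@turan_adj r n).
Proof. by move=> i; rewrite /turan_adj eqxx. Qed.

Definition turan (r n : nat) : sgraph 'I_n :=
  SGraph (@turan_adj_sym r n) (@turan_adj_irrefl r n).

Lemma card_turan_part r n k : (k < r)%N ->
  #|[pred i : 'I_n | i %% r == k]|%N = (n %/ r + (k < n %% r))%N.
Proof.
move=> kr; have r0 : (0 < r)%N by exact: leq_ltn_trans kr.
rewrite -sum1_card big_mkcond /=.
elim: n => [|n IHn]; first by rewrite big_ord0 div0n mod0n ltn0.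
rewrite big_ord_recr /= IHn divnS// modnS unfold_in /=.
have nr := ltn_pmod n r0.
have -> : (r %| n.+1)%N = ((n %% r).+1 == r).
  apply/idP/eqP => [|nr1].
    rewrite /dvdn -addn1 -modnDml addn1; move: nr; rewrite leq_eqVlt.
    by move=> /orP[/eqP|] // nr; rewrite modn_small.
  by rewrite /dvdn -addn1 -modnDml addn1 nr1 modnn.
by move: nr; move: (n %/ r)%N (n %% r)%N => q m nr; do 2!case: eqP => ? /=; lia.
Qed.

(* (k, i) is the i-th vertex of the k-th part; the additional edge joins the
   vertices 0 and 1 of part 0.  It exists only when t >= 2: for t <= 1 this is
   the plain complete r-partite graph. *)
Definition Kplus_adj (r t : nat) : rel ('I_r * 'I_t) :=
  fun u v => (u.1 != v.1) ||
    [&& (u.1 == 0 :> nat), (v.1 == 0 :> nat) &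
        ((u.2 == 0 :> nat) && (v.2 == 1 :> nat)) ||
        ((u.2 == 1 :> nat) && (v.2 == 0 :> nat))]%N.

Lemma Kplus_adj_sym r t : symmetric (@Kplus_adj r t).
Proof.
move=> u v; rewrite /Kplus_adj eq_sym; congr (_ || _).
by rewrite andbCA; do 2!congr (_ && _); rewrite orbC andbC (andbC (u.2 == _ :> nat)).
Qed.

Lemma Kplus_adj_irrefl r t : irreflexive (@Kplus_adj r t).
Proof. by move=> [a [[|[|i]] hi]]; rewrite /Kplus_adj /= eqxx /= ?andbF. Qed.

Definition Kplus (r t : nat) : sgraph ('I_r * 'I_t)%type :=
  SGraph (@Kplus_adj_sym r t) (@Kplus_adj_irrefl r t).

(* Main.v *)
(* Lambda below is the p-spectral radius and q = 1 - 1/p.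

   Let H = G[A], |A| = m, with A of least order among the vertex sets such that
   Lambda(G[A]) >= Lambda(G) (m/n)^(q(2 - theta)), where theta = r^-4/2.  Since
   Lambda(H) <= m^(2q), such an m is at least sqrt n.  If H had a vertex of
   degree at most (1 - 1/r - 2 theta)m, the eigenvector equations would give
   s <= (1 - theta)/m for the smallest p-th power s of an entry of the
   eigenvector, and deleting that vertex would contradict the minimality of A.
   So every vertex of H misses at most (1/r + 2 theta)m vertices.

   H contains K_{r+1}.  Otherwise Erdos' degree majorization turns it into a
   complete r-partite graph: if A is the whole vertex set this contradicts
   Lambda(G) > Lambda(T_r(n)) because balancing the parts does not decrease
   Lambda, and if m < n then Lambda(H) > (1 - 1/r) m^(2q) contradicts the
   Motzkin-Straus bound.

   Some edge uv of that K_{r+1} has so many common neighbours that r - 1 sets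
   of vertices inside N(u) and N(v), and one in A, can be chosen greedily: from
   K s disjoint tuples, each with at least 2m/K common neighbours, the pigeonhole
   principle over the subsets of the tuples selects s tuples with s common
   neighbours.  Logarithmic size is lost only through the number 2^(K s) of
   subsets. *)
Require Import Defs.
From HB Require Import structures.
From mathcomp Require Import all_boot all_order all_algebra.
From mathcomp Require Import all_classical all_reals all_analysis.
From mathcomp Require Import fintype finset zify ring lra.
Set Implicit Arguments.
Unset Strict Implicit.
Unset Printing Implicit Defensive.
Import Order.TTheory GRing.Theory Num.Theory.
Import numFieldNormedType.Exports.
Local Open Scope ring_scope.

(** * Blow-up of a clique *)

Definition clique (T : finType) (e : rel T) (S : {set T}) : bool :=
  [forall u in S, forall v in S, (u != v) ==> e u v].

Lemma cliqueP (T : finType) (e : rel T) (S : {set T}) :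
  reflect (forall u v, u \in S -> v \in S -> u != v -> e u v) (clique e S).
Proof.
apply: (iffP forall_inP) => h u.
  move=> v uS vS; exact/implyP/(forall_inP (h u uS)).
by move=> uS; apply/forall_inP => v vS; apply/implyP; exact: h.
Qed.

(* Erdos' proof of Turan's theorem, with weights on the vertices: the
   non-neighbours of a vertex of largest weighted degree form one class. *)
Lemma degree_majorization (R : realDomainType) (T : finType) (e : rel T)
    (x : T -> R) (r : nat) (A : {set T}) :
  symmetric e -> irreflexive e -> (forall v, 0 <= x v) ->
  (forall S : {set T}, S \subset A -> clique e S -> #|S| != r.+1) ->
  exists f : T -> nat, (forall v, v \in A -> (f v < r)%N) /\
    (forall v, v \in A -> \sum_(w in A | e v w) x w <=
                          \sum_(w in A | f w != f v) x w).
Proof.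
move=> esym eirr x0; elim: r A => [|r IHr] A noK.
  have c1 v : clique e [set v].
    by apply/cliqueP => a b /set1P-> /set1P->; rewrite eqxx.
  by exists (fun=> 0%N); split=> v vA; have := noK [set v];
    rewrite sub1set vA cards1 eqxx => /(_ isT (c1 v)).
have [->|[v0 v0A]] := set_0Vmem A.
  by exists (fun=> 0%N); split=> v; rewrite inE.
pose d v := \sum_(w in A | e v w) x w.
have [v vA vmax] : exists2 v, v \in A & forall w, w \in A -> d w <= d v.
  by case: (Order.TotalTheory.arg_maxP d v0A) => v vA vmax; exists v.
pose B := [set w in A | e v w].
have BA : B \subset A by apply/subsetP => w; rewrite inE => /andP[].
have [S SB cS|f [f_lt f_le]] := IHr B.
  have vS : v \notin S.
    by apply/negP => /(subsetP SB); rewrite inE eirr andbF.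
  have := noK (v |: S); rewrite cardsU1 vS add1n eqSS; apply.
    by rewrite subUset sub1set vA (subset_trans SB).
  have vadj w : w \in S -> e v w.
    by move=> /(subsetP SB); rewrite inE => /andP[].
  apply/cliqueP => a b /setU1P[->|aS] /setU1P[->|bS] ab.
  - by rewrite eqxx in ab.
  - exact: vadj.
  - by rewrite esym vadj.
  - by move/cliqueP : cS; apply.
pose g w := if w \in B then f w else r.
exists g; split=> [w wA|w wA].
  by rewrite /g; case: ifPn => // /f_lt/ltnW.
have [wB|wB] := boolP (w \in B); last first.
  (* Outside [B] the class of [w] is [r], so the vertices of other classes are exactly those of [B]
     and the right-hand side is the maximum [d v]. *)
  apply: le_trans (vmax w wA) _; rewrite /d le_eqVlt; apply/orP; left.
  apply/eqP/eq_bigl => z; rewrite /g (negbTE wB).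
  have [zB|] := boolP (z \in B).
    rewrite (subsetP BA)//= ltn_eqF ?f_lt//.
    by move: zB; rewrite inE => /andP[_ ->].
  by rewrite eqxx andbF inE => /negbTE.
have split_B (P : pred T) : \sum_(z in A | P z) x z =
    \sum_(z in B | P z) x z + \sum_(z in A :\: B | P z) x z.
  rewrite (bigID (mem B))/=; congr (_ + _); apply: eq_bigl => z.
    have /implyP := subsetP BA z.
    by case: (z \in B); case: (z \in A); case: (P z).
  by rewrite in_setD; case: (z \in B); case: (z \in A); case: (P z).
rewrite !split_B; apply: lerD.
  apply: le_trans (f_le w wB) _; rewrite le_eqVlt; apply/orP; left; apply/eqP/eq_bigl => z.
  by rewrite /g wB; case: (z \in B).
(* For [w] in [B] every vertex of [A :\: B] is in another class, so this share of the right-hand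
   side is the largest possible. *)
rewrite [leRHS](eq_bigl (fun z => z \in A :\: B)).
  rewrite [leRHS](bigID (e w))/= lerDl.
  by rewrite sumr_ge0.
move=> z; rewrite /g wB inE; case: (z \in B) => //=.
by rewrite gtn_eqF ?f_lt// andbT.
Qed.

(* Many vertices lie in at least s of the sets X i; two of them are equivalent
   when they lie in the same ones. *)
Lemma common_rows (T : finType) (A : {set T}) (K s : nat)
    (X : 'I_(K * s) -> {set T}) :
  (0 < K)%N -> (0 < s)%N ->
  (forall i, X i \subset A) -> (forall i, (2 * #|A| <= K * #|X i|)%N) ->
  (K * s * 2 ^ (K * s) <= #|A|)%N ->
  exists S : {set 'I_(K * s)}, exists Y : {set T},
    [/\ (s <= #|S|)%N, (s <= #|Y|)%N & forall i, i \in S -> Y \subset X i].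
Proof.
move=> K0 s0 XA Xbig Abig; set m := (K * s)%N in X XA Xbig Abig *.
pose rows x := [set i | x \in X i].
pose good := [set x in A | s <= #|rows x|]%N.
have dc : (\sum_i #|X i| = \sum_(x in A) #|rows x|)%N.
  transitivity (\sum_(i < m) \sum_(x in A) (x \in X i))%N.
    apply: eq_bigr => i _; rewrite -sum1_card big_mkcond/= [RHS]big_mkcond/=.
    apply: eq_bigr => x _; case: (boolP (x \in X i)) => [/(subsetP (XA i))->//|].
    by case: (x \in A).
  rewrite exchange_big/=; apply: eq_bigr => x _.
  rewrite -sum1_card [RHS]big_mkcond/=.
  by apply: eq_bigr => i _; rewrite inE; case: (x \in X i).
have sum_ub : (\sum_(x in A) #|rows x| <= #|good| * m + #|A| * s)%N.
  rewrite (bigID (mem good))/=; apply: leq_add.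
    rewrite -sum_nat_const [leqLHS](eq_bigl (mem good)); last first.
      by move=> x; rewrite /good !inE; case: (x \in A).
    by apply: leq_sum => x _; rewrite -[leqRHS]card_ord max_card.
  rewrite -sum_nat_const big_mkcondr/=; apply: leq_sum => x xA.
  by case: ifPn => //; rewrite /good inE xA/= -ltnNge => /ltnW.
have sum_lb : (m * (2 * #|A|) <= K * \sum_i #|X i|)%N.
  rewrite big_distrr/= -[X in (X * _ <= _)%N]card_ord -sum_nat_const.
  by apply: leq_sum => i _; exact: Xbig.
(* There are at least [2 * s * #|A|] incidences, and the vertices that are not good account for at
   most [s * #|A|] of them; each good vertex has at most [m = K * s]. *)
have good_ge : (#|A| <= K * #|good|)%N.
  rewrite -(@leq_pmul2l m) ?muln_gt0 ?K0//; rewrite dc in sum_lb.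
  have : (m * (2 * #|A|) <= K * (#|good| * m + #|A| * s))%N.
    by apply: leq_trans sum_lb _; rewrite leq_mul2l sum_ub orbT.
  by rewrite /m; nia.
have good_big : (s * 2 ^ m <= #|good|)%N.
  rewrite -(@leq_pmul2l K)// mulnA; exact: leq_trans good_ge.
pose fib (S : {set 'I_m}) := [set x in good | rows x == S].
have [/existsP[S /andP[sS sF]]|/existsPn none] :=
    boolP [exists S : {set 'I_m}, (s <= #|S|)%N && (s <= #|fib S|)%N].
  exists S, (fib S); split=> // i iS; apply/subsetP => x.
  by rewrite !inE => /andP[_ /eqP E]; move: iS; rewrite -E inE.
(* A pattern with fewer than [s] indices has an empty fibre, and any other would have at most
   [s - 1] vertices, so the [2 ^ m] patterns could not cover [good]. *)
have : (#|good| <= \sum_(S : {set 'I_m}) s.-1)%N.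
  have -> : (#|good| = \sum_(S : {set 'I_m}) #|fib S|)%N.
    rewrite -sum1_card (partition_big rows xpredT)//=; apply: eq_bigr => S _.
    by rewrite -sum1_card; apply: eq_bigl => x; rewrite !inE.
  apply: leq_sum => S _; have := none S; rewrite negb_and -!ltnNge => /orP[sS|].
    rewrite [leqLHS](_ : _ = 0%N)//; apply: eq_card0 => x; rewrite !inE.
    apply/negP => /andP[/andP[_ sx] /eqP E].
    by move: sS; rewrite -E ltnNge sx.
  by rewrite -[X in (_ < X)%N]prednK.
rewrite sum_nat_const -cardsT -powersetT card_powerset cardsT card_ord => good_le.
have := leq_trans good_big good_le; rewrite mulnC leq_pmul2l ?expn_gt0//.
by rewrite leqNgt ltn_predL s0.
Qed.

(** The [i]-th tuple is [w 0 i, ..., w (a - 1) i]. Classes are chosen one at a time: out of [K * s]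
    tuples, [common_rows] keeps [s] that have [s] common neighbours in [C a], and these neighbours
    form the next class. Each round costs a factor [K], hence the initial length [K ^ r * t]. *)
Lemma blowup (T : finType) (e : rel T) (A : {set T}) (K t r : nat)
    (C : nat -> {set T}) :
  (0 < K)%N -> (0 < t)%N -> (forall a, (a < r)%N -> C a \subset A) ->
  (forall a (w : nat -> T), (a < r)%N -> (forall b, (b < a)%N -> w b \in A) ->
    (2 * #|A| <= K * #|[set x in C a | [forall b : 'I_a, e (w b) x]]|)%N) ->
  (4 ^ (K ^ r * t) <= #|A|)%N ->
  exists w : nat -> nat -> T,
    [/\ forall a i, (a < r)%N -> (i < t)%N -> w a i \in C a,
        forall a i j, (a < r)%N -> (i < t)%N -> (j < t)%N ->
          w a i = w a j -> i = j &
        forall a b i j, (a < b)%N -> (b < r)%N -> (i < t)%N -> (j < t)%N ->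
          e (w a i) (w b j)].
Proof.
move=> K0 t0 CA deg Abig.
have [x0 x0A] : exists x0, x0 \in A.
  by apply/card_gt0P; apply: leq_trans Abig; rewrite expn_gt0.
suff /(_ r (leqnn r)) : forall a, (a <= r)%N -> exists w : nat -> nat -> T,
    [/\ forall b i, (b < a)%N -> (i < K ^ (r - a) * t)%N -> w b i \in C b,
        forall b i j, (b < a)%N -> (i < K ^ (r - a) * t)%N ->
          (j < K ^ (r - a) * t)%N -> w b i = w b j -> i = j &
        forall b c i j, (b < c)%N -> (c < a)%N -> (i < K ^ (r - a) * t)%N ->
          (j < K ^ (r - a) * t)%N -> e (w b i) (w c j)].
  by rewrite subnn expn0 mul1n.
elim=> [|a IHa] ar; first by exists (fun _ _ => x0); split.
have [w [wC winj wadj]] := IHa (ltnW ar).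
set s := (K ^ (r - a.+1) * t)%N.
have ms : (K ^ (r - a) * t = K * s)%N by rewrite /s -(subnSK ar) expnS mulnA.
rewrite ms in wC winj wadj.
have s0 : (0 < s)%N by rewrite muln_gt0 expn_gt0 K0.
pose X (i : 'I_(K * s)) := [set x in C a | [forall b : 'I_a, e (w b i) x]].
have [|||S [Y [sS sY YX]]] := common_rows (A := A) (X := X) K0 s0.
- by move=> i; apply: subset_trans (CA _ ar); apply/subsetP => x; rewrite inE => /andP[].
- move=> i; apply: (deg a (fun b => w b i)) => // b ba.
  by apply: (subsetP (CA b (ltn_trans ba ar))); apply: wC.
(* With [M = K * s], at most [K ^ r * t], this is [M * 2 ^ M <= 4 ^ M]. *)
- apply: leq_trans Abig.
  have : (K * s <= K ^ r * t)%N.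
    rewrite -ms leq_mul2r; apply/orP; right; apply: leq_pexp2l => //; exact: leq_subr.
  move=> /(leq_pexp2l (isT : (0 < 4)%N)); apply: leq_trans.
  by rewrite (expnMn 2 2) leq_mul2r ltnW ?orbT// ltn_expl.
have k0 : 'I_(K * s) by exists 0%N; rewrite muln_gt0 K0.
pose g i := nth k0 (enum S) i.
pose h i := nth x0 (enum Y) i.
have gS i : (i < s)%N -> g i \in S.
  by move=> si; rewrite -mem_enum mem_nth// -cardE (leq_trans si).
have hY i : (i < s)%N -> h i \in Y.
  by move=> si; rewrite -mem_enum mem_nth// -cardE (leq_trans si).
have ginj i j : (i < s)%N -> (j < s)%N -> g i = g j -> i = j.
  move=> si sj /eqP; rewrite nth_uniq ?enum_uniq -?cardE ?(leq_trans _ sS)//.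
  by move/eqP.
have hinj i j : (i < s)%N -> (j < s)%N -> h i = h j -> i = j.
  move=> si sj /eqP; rewrite nth_uniq ?enum_uniq -?cardE ?(leq_trans _ sY)//.
  by move/eqP.
have adjh b i j : (b < a)%N -> (i < s)%N -> (j < s)%N -> e (w b (g i)) (h j).
  move=> ba si sj; have := subsetP (YX _ (gS _ si)) _ (hY _ sj).
  by rewrite inE => /andP[_ /forallP /(_ (Ordinal ba))].
(* The kept tuples are renumbered by [g], and [h] lists the new class. *)
exists (fun b i => if b == a then h i else w b (g i)); split.
- move=> b i; rewrite ltnS leq_eqVlt; case: eqVneq => [->|ba]/= bla si.
    by have := subsetP (YX _ (gS _ si)) _ (hY _ si); rewrite inE => /andP[].
  exact: wC.
- move=> b i j; rewrite ltnS leq_eqVlt; case: eqVneq => [->|ba]/= bla si sj.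
    exact: hinj.
  by move=> /winj E; apply: ginj => //; apply/val_inj/E.
- move=> b c i j bc; rewrite ltnS leq_eqVlt; case: (eqVneq c a) => [ca|ca]/= ca' si sj.
    by rewrite ltn_eqF -?ca//; apply: adjh; rewrite -?ca.
  by rewrite ltn_eqF ?(ltn_trans bc)//; apply: wadj.
Qed.

(* Double counting over the pairs of S, with a(a-1) >= 2(r-1)a - r(r-1) for the
   number a of neighbours in S of a vertex. *)
Lemma clique_joint_edge (T : finType) (e : rel T) (r : nat) (A S : {set T}) :
  (0 < r)%N -> #|S| = r.+1 ->
  exists u v, [/\ u \in S, v \in S, u != v &
    (2 * r.-1 * \sum_(w in S) #|[set x in A | e w x]| <=
     r * r.+1 * #|[set x in A | e u x && e v x]| + r * r.-1 * #|A|)%N].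
Proof.
move=> r0 cS; set sumdeg := (\sum_(w in S) _)%N.
pose N u v := #|[set x in A | e u x && e v x]|.
pose a x := (\sum_(u in S) e u x)%N.
have cN u v : N u v = (\sum_(x in A) (e u x * e v x))%N.
  rewrite /N -sum1_card big_mkcond/= [RHS]big_mkcond/=.
  by apply: eq_bigr => x _; rewrite inE; case: (x \in A); case: (e u x); case: (e v x).
have sumdegE : sumdeg = (\sum_(x in A) a x)%N.
  rewrite exchange_big; apply: eq_bigr => u _.
  rewrite -sum1_card big_mkcond/= [RHS]big_mkcond/=.
  by apply: eq_bigr => x _; rewrite inE; case: (x \in A); case: (e u x).
have sumNE : (\sum_(u in S) \sum_(v in S) N u v = \sum_(x in A) a x * a x)%N.
  under eq_bigr do under eq_bigr do rewrite cN.
  under eq_bigr do rewrite exchange_big.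
  rewrite exchange_big; apply: eq_bigr => x _.
  by rewrite big_distrl/=; apply: eq_bigr => u _; rewrite big_distrr.
have offdiag : (\sum_(u in S) \sum_(v in S | v != u) N u v + sumdeg =
                \sum_(x in A) a x * a x)%N.
  rewrite -sumNE -big_split/=; apply: eq_bigr => u uS.
  rewrite [RHS](bigD1 u)//= addnC; congr (_ + _)%N.
  by rewrite /N; apply: eq_card => x; rewrite !inE andbb.
have lb : (2 * r.-1 * sumdeg <= \sum_(u in S) \sum_(v in S | v != u) N u v + r * r.-1 * #|A|)%N.
  rewrite -(leq_add2r sumdeg) addnAC offdiag sumdegE big_distrr/= -big_split/=.
  have -> : (r * r.-1 * #|A| = \sum_(x in A) r * r.-1)%N.
    by rewrite sum_nat_const mulnC.
  rewrite -big_split/=; apply: leq_sum => x _.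
  (* With [r] now standing for its predecessor, the claim is [(a x - r) * (a x - r - 1) >= 0], a
     product of consecutive integers. *)
  case: r r0 {cS} => // r _ /=; have [h|h] := leqP (a x) r; nia.
have [/existsP[u /existsP[v /and4P[uS vS uv h]]]|/existsPn none] :=
    boolP [exists u, exists v, [&& u \in S, v \in S, u != v &
      2 * r.-1 * sumdeg <= r * r.+1 * N u v + r * r.-1 * #|A|]%N].
  by exists u, v.
(* If every pair failed, summing over the [r * r.+1] ordered pairs would contradict [lb]. *)
suff : (\sum_(u in S) \sum_(v in S | v != u) (r * r.+1 * N u v + r * r.-1 * #|A|) <
  \sum_(u in S) \sum_(v in S | v != u) (2 * r.-1 * sumdeg))%N.
  have pairs c : (\sum_(u in S) \sum_(v in S | v != u) c = r.+1 * r * c)%N.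
    rewrite (eq_bigr (fun=> (r * c)%N)) ?sum_nat_const ?cS ?mulnA// => u uS.
    rewrite sum_nat_const; congr (_ * _)%N.
    have := cardsD1 u S; rewrite uS cS add1n => -[->].
    by apply: eq_card => v; rewrite !inE andbC.
  rewrite pairs; under eq_bigr do rewrite big_split/= -big_distrr/=.
  by rewrite big_split/= -big_distrr/= pairs; nia.
have none' u v : u \in S -> v \in S -> v != u ->
    (r * r.+1 * N u v + r * r.-1 * #|A| < 2 * r.-1 * sumdeg)%N.
  move=> uS vS vu; rewrite ltnNge; apply/negP => h.
  have /existsPn /(_ v) := none u.
  by rewrite uS vS eq_sym vu h.
have [u uS] : exists u, u \in S by apply/card_gt0P; rewrite cS.
have [v vS] : exists v, v \in S :\ u.
  by apply/card_gt0P; have := cardsD1 u S; rewrite uS cS add1n => -[<-].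
move: vS; rewrite !inE => /andP[vu vS].
rewrite (bigD1 u)//= [ltnRHS](bigD1 u)//= -addSn; apply: leq_add.
  rewrite (bigD1 v) ?vS//= [leqRHS](bigD1 v) ?vS//= -addSn; apply: leq_add.
    exact: none'.
  by apply: leq_sum => w /andP[/andP[wS wu] _]; apply/ltnW/none'.
apply: leq_sum => w /andP[wS _]; apply: leq_sum => z /andP[zS zw].
exact/ltnW/none'.
Qed.

(** A union bound: each [w i] misses at most [#|A| - b] vertices of [A], hence of [C]. *)
Lemma common_neighbours (R : realDomainType) (T : finType) (e : rel T)
    (A C : {set T}) (b : R) (a : nat) (w : nat -> T) :
  C \subset A ->
  (forall v, v \in A -> b <= #|[set x in A | e v x]|%:R) ->
  (forall i, (i < a)%N -> w i \in A) ->
  #|C|%:R - a%:R * (#|A|%:R - b) <=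
    #|[set x in C | [forall i : 'I_a, e (w i) x]]|%:R :> R.
Proof.
move=> CA deg wA; pose nb i := [set x in A | e (w i) x].
rewrite lerBlDr; have cover : (#|C| <=
    #|[set x in C | [forall i : 'I_a, e (w i) x]]| + \sum_(i < a) #|A :\: nb i|)%N.
  have -> : (#|C| = \sum_(x in C) 1)%N by rewrite sum1_card.
  have -> : (\sum_(i < a) #|A :\: nb i| = \sum_(i < a) \sum_(x in A) (~~ e (w i) x))%N.
    apply: eq_bigr => i _; rewrite -sum1_card big_mkcond/= [RHS]big_mkcond/=.
    apply: eq_bigr => x _; rewrite !inE.
    by case: (x \in A) => //; case: (e (w i) x).
  rewrite -sum1_card big_mkcond/= exchange_big/= [X in (_ <= X + _)%N]big_mkcond/=.
  rewrite [X in (_ <= _ + X)%N]big_mkcond/= -big_split/=; apply: leq_sum => x _.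
  have [xC|//] := boolP (x \in C); rewrite (subsetP CA)// inE xC/=.
  have [//|/forallPn [i]] := boolP [forall i : 'I_a, e (w i) x].
  by rewrite (bigD1 i)//= => ->; rewrite addnC.
move: cover; rewrite -(ler_nat R) natrD => /le_trans; apply; rewrite lerD2l.
rewrite natr_sum; apply: (@le_trans _ _ (\sum_(i < a) (#|A|%:R - b))); last first.
  by rewrite sumr_const card_ord mulr_natl.
apply: ler_sum => i _; have := deg _ (wA i (ltn_ord i)).
have -> : (#|A| = #|nb i| + #|A :\: nb i|)%N.
  rewrite -(cardsID (nb i) A); congr (_ + _)%N; apply: eq_card => x.
  by rewrite !inE; case: (x \in A).
by rewrite -/(nb i) natrD; lra.
Qed.

(** The edge [uv] of [clique_joint_edge] becomes the extra edge. The first [r - 1] classes are found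
    among the common neighbours [B] of [u] and [v], the last one in [A] without [u] and [v]; two of
    its vertices then give way to [u] and [v]. The factor [6 * r ^ 3] is large enough for both kinds
    of class in [blowup]. *)
Lemma dense_clique_contains_Kplus (R : realFieldType) (T : finType)
    (G : sgraph T) (r t : nat) (A S : {set T}) :
  (2 <= r)%N -> (2 <= t)%N -> S \subset A -> clique G S -> #|S| = r.+1 ->
  (forall w, w \in A ->
    (1 - r%:R^-1 - r%:R ^- 4) * #|A|%:R <= #|[set x in A | G w x]|%:R :> R) ->
  (4 ^ ((6 * r ^ 3) ^ r * t) <= #|A|)%N ->
  contains G (Kplus r t).
Proof.
move=> r2 t2 SA cS cardS deg Abig.
have r0 : (0 < r)%N by exact: ltnW.
have [u [v [uS vS uv joint]]] := clique_joint_edge G A r0 cardS.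
have Guv : G u v by exact: (cliqueP _ _ cS).
set B := [set x in A | G u x && G v x] in joint.
set b : R := _ * #|A|%:R in deg.
have deg_sum : r.+1%:R * b <= (\sum_(w in S) #|[set x in A | G w x]|)%:R.
  rewrite natr_sum mulr_natl -cardS -sumr_const; apply: ler_sum => w wS.
  exact/deg/(subsetP SA).
move: joint; rewrite -(ler_nat R) !natrD !natrM => joint.
have rho2 : 2 <= r%:R :> R by rewrite ler_nat.
have rho0 : 0 < r%:R :> R by rewrite ltr0n.
pose k : R := #|A|%:R.
have k_big : 3 * r%:R <= k.
  rewrite -natrM ler_nat; apply: leq_trans Abig.
  have [s s0 ->] : exists2 s, (0 < s)%N & ((6 * r ^ 3) ^ r * t = 3 * r * s)%N.
    exists (2 * r ^ 2 * (6 * r ^ 3) ^ r.-1 * t)%N.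
      by rewrite !(muln_gt0, expn_gt0) r0/= ltnW.
    have -> : ((6 * r ^ 3) ^ r = (6 * r ^ 3) * (6 * r ^ 3) ^ r.-1)%N.
      by rewrite -expnS prednK.
    by ring.
  apply: leq_trans (ltnW (ltn_expl _ _)) => //; exact: leq_pmulr.
have k0 : 0 < k by apply: lt_le_trans k_big; rewrite mulr_gt0.
have bE : b * r%:R ^+ 4 = (r%:R ^+ 4 - r%:R ^+ 3 - 1) * k.
  by rewrite /b -/k; field; rewrite gt_eqF.
have kb : (k - b) * r%:R ^+ 4 = (r%:R ^+ 3 + 1) * k by rewrite mulrBl bE; ring.
have kb0 : 0 <= k - b.
  by rewrite -(pmulr_lge0 _ (exprn_gt0 4 rho0)) kb mulr_ge0 ?addr_ge0 ?exprn_ge0 ?ltW.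
have joint' : 2 * (r%:R - 1) * (r%:R + 1) * b
    <= r%:R * (r%:R + 1) * #|B|%:R + r%:R * (r%:R - 1) * k.
  have rp : r.-1%:R = r%:R - 1 :> R by rewrite -subn1 natrB.
  have rs : r.+1%:R = r%:R + 1 :> R by rewrite -natr1.
  move: joint deg_sum; rewrite rp rs -/k => joint deg_sum.
  have : 2 * (r%:R - 1) * ((r%:R + 1) * b) <= 2 * (r%:R - 1) *
      (\sum_(w in S) #|[set x in A | G w x]|)%:R.
    by rewrite ler_wpM2l// mulr_ge0//; lra.
  by move: joint; lra.
pose C a := if (a.+1 < r)%N then B else A :\: [set u; v].
have CA a : C a \subset A.
  by rewrite /C; case: ifP => _; apply/subsetP => x; rewrite !inE => /andP[].
have K0 : (0 < 6 * r ^ 3)%N by rewrite muln_gt0 expn_gt0 r0.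
have [|w [wC winj wadj]] := blowup (e := G) K0 (ltnW t2)
    (fun a (_ : (a < r)%N) => CA a) _ Abig.
  move=> a w ar wA; rewrite -(ler_nat R) natrM natrM natrM natrX -/k.
  have K6 : 0 <= 6 * r%:R ^+ 3 :> R by rewrite mulr_ge0 ?exprn_ge0// ltW.
  set ext := [set x in _ | _].
  have ext_ge : #|C a|%:R - a%:R * (k - b) <= #|ext|%:R.
    exact: (common_neighbours (CA a) deg wA).
  apply: le_trans (ler_wpM2l _ ext_ge); last by [].
  have pos4 : 0 < r%:R ^+ 4 :> R by rewrite exprn_gt0.
  have [ar1|ar1] := ltnP a.+1 r.
    rewrite /C ar1/=; have : a%:R + 2 <= r%:R :> R by rewrite -natrD ler_nat addn2.
    move=> /(fun h => ler_wpM2r kb0 h) ab.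
    apply: (@le_trans _ _ (6 * r%:R ^+ 3 * (#|B|%:R - (r%:R - 2) * (k - b)))); last first.
      by apply: ler_wpM2l => //; move: ab; lra.
    rewrite -(ler_pM2r (_ : 0 < r%:R ^+ 2 * (r%:R + 1))); last by rewrite mulr_gt0 ?exprn_gt0 ?addr_gt0.
    move: joint' kb bE k0 rho2; move: (r%:R) (k) (b) (#|B|%:R : R) => p k' b' q J kb bE k0 p2.
    have J' := ler_wpM2l (_ : 0 <= 6 * p ^+ 4) J.
    have E1 : 6 * p ^+ 4 * (2 * (p - 1) * (p + 1) * b') =
        12 * (p - 1) * (p + 1) * ((p ^+ 4 - p ^+ 3 - 1) * k').
      by rewrite -bE; ring.
    have E2 : 6 * p ^+ 3 * (q - (p - 2) * (k' - b')) * (p ^+ 2 * (p + 1)) =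
        6 * p ^+ 5 * (p + 1) * q - 6 * p * (p + 1) * (p - 2) * ((p ^+ 3 + 1) * k').
      by rewrite -kb; ring.
    (* Once [b'] is eliminated by [E1] and [E2], all terms of degree at least four in [p] cancel,
       and this is the remaining difference. *)
    have : 0 <= (4 * p ^+ 2 * (p - 2) + 12 * p + 12) * k'.
      have p2' : 0 <= p ^+ 2 * (p - 2) by rewrite mulr_ge0 ?exprn_ge0//; lra.
      by apply: mulr_ge0; [move: p2'; lra | exact: ltW].
    have /J' : 0 <= 6 * p ^+ 4 by rewrite mulr_ge0 ?exprn_ge0//; lra.
    by rewrite E1 E2 => {}J' P; move: P J'; lra.
  have ar' : a = r.-1 by apply/eqP; rewrite -eqSS prednK// eqn_leq ar ar1.
  rewrite /C ltnNge ar1/=.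
  have -> : a%:R = r%:R - 1 :> R by rewrite ar' -subn1 natrB.
  have cD : k - 2 <= #|A :\: [set u; v]|%:R.
    rewrite lerBlDr -natrD ler_nat addnC -(cardsID [set u; v] A) leq_add2r.
    by apply: leq_trans (subset_leq_card (subsetIr _ _)) _; rewrite cards2; case: eqP.
  apply: (@le_trans _ _ (6 * r%:R ^+ 3 * (k - 2 - (r%:R - 1) * (k - b)))); last first.
    by apply: ler_wpM2l => //; move: cD; lra.
  rewrite -(ler_pM2r rho0).
  move: kb k_big k0 rho2; move: (r%:R) (k) (b) => p k' b' kb k_big k0 p2.
  have -> : 6 * p ^+ 3 * (k' - 2 - (p - 1) * (k' - b')) * p =
    6 * p ^+ 4 * (k' - 2) - 6 * (p - 1) * ((p ^+ 3 + 1) * k') by rewrite -kb; ring.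
  have pp : 0 <= p ^+ 2 - 4 by rewrite (_ : _ - _ = (p - 2) * (p + 2)); [apply: mulr_ge0; lra | ring].
  (* The coefficient of [k'] in the difference is [6p^3 - 8p + 6]; with [k' >= 3 * p] it absorbs the
     [12p^4] lost by excluding [u] and [v]. *)
  have P1 : 0 <= (k' - 3 * p) * (6 * p * (p ^+ 2 - 4) + 16 * p + 6).
    have P0 : 0 <= p * (p ^+ 2 - 4) by rewrite mulr_ge0//; lra.
    by apply: mulr_ge0; [rewrite subr_ge0 | move: P0; lra].
  have P2 : 0 <= p ^+ 2 * (p ^+ 2 - 4) by rewrite mulr_ge0 ?exprn_ge0//; lra.
  by move: P1 P2; lra.
have CB a x : (a.+1 < r)%N -> x \in C a -> G u x && G v x.
  by rewrite /C => ->; rewrite inE => /andP[].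
have lastC i : (i < t)%N -> (w r.-1 i != u) && (w r.-1 i != v).
  move=> /(wC r.-1 i); rewrite prednK// leqnn => /(_ isT).
  by rewrite /C prednK// ltnn !inE negb_or => /andP[].
pose z a i := if a == r.-1 then (if i is 0 then u else if i is 1 then v else w a i)
              else w a i.
have zadj a c i j : (a < c)%N -> (c < r)%N -> (i < t)%N -> (j < t)%N -> G (z a i) (z c j).
  move=> ac cr it jt; have ar : (a.+1 < r)%N by exact: leq_ltn_trans cr.
  rewrite /z ifN; last by rewrite neq_ltn ltn_predRL ar.
  have /andP[ua va] := CB a _ ar (wC a i (ltnW ar) it).
  have wac := wadj a c i j ac cr it jt.
  by case: ifP => // _; case: j jt wac => [|[|j]] // _ _; rewrite adj_sym.
have zinj a i j : (a < r)%N -> (i < t)%N -> (j < t)%N -> z a i = z a j -> i = j.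
  move=> ar it jt; rewrite /z; case: eqP => [ae|_]; last exact: winj.
  have := lastC i it; have := lastC j jt; rewrite -ae.
  case: i it => [|[|i]] it; case: j jt => [|[|j]] jt // => /andP[ju jv] /andP[iu iv].
  - by move=> E; rewrite E eqxx in uv.
  - by move=> E; rewrite -E eqxx in ju.
  - by move=> E; rewrite E eqxx in uv.
  - by move=> E; rewrite -E eqxx in jv.
  - by move=> E; rewrite E eqxx in iu.
  - by move=> E; rewrite E eqxx in iv.
  - exact: winj.
(* part 0 of K_r^+(t), which carries the extra edge, is the last set of the
   blow-up, whose first two vertices are replaced by u and v *)
pose part m := if m is m'.+1 then m' else r.-1.
have part_lt (i : 'I_r) : (part i < r)%N.
  by rewrite /part; case: i => [[|i] ir]/=; [rewrite ltn_predL | exact: ltnW].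
have part_inj (i j : 'I_r) : i != j -> part i != part j.
  case: i j => [[|i] ir] [[|j] jr]; rewrite -(inj_eq val_inj)//= /part => _.
    by rewrite eq_sym neq_ltn ltn_predRL jr.
  by rewrite neq_ltn ltn_predRL ir.
pose f (q : 'I_r * 'I_t) := z (part q.1) q.2.
have fadj q q' : q.1 != q'.1 -> G (f q) (f q').
  move=> /part_inj; rewrite neq_ltn => /orP[lt|lt]; last rewrite adj_sym.
    by apply: zadj.
  by apply: zadj.
exists f.
  move=> q q'; have [E|/fadj] := eqVneq q.1 q'.1; last first.
    by move=> h E; rewrite E adj_irrefl in h.
  rewrite /f E => /(zinj _ _ _ (part_lt _) (ltn_ord _) (ltn_ord _))/val_inj.
  by case: q q' E => [q1 q2] [q1' q2'] /= -> ->.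
move=> q q' /orP[/fadj//|/and3P[/eqP q1 /eqP q1' ends]].
rewrite /f q1 q1' /z eqxx.
by case/orP: ends => /andP[/eqP-> /eqP->] //; rewrite adj_sym.
Qed.

(** * The quadratic form of a graph *)

Section powR.
Variables (R : realType) (p : R).
Hypothesis p1 : 1 < p.

(** The tangent at [a] lies below the convex function; this is Young's inequality for [z] and
    [a ^ (p - 1)]. *)
Lemma powR_tangent (a z : R) : 0 <= a -> 0 <= z ->
  p * a `^ (p - 1) * z - (p - 1) * a `^ p <= z `^ p.
Proof.
move=> a0 z0; have p0 : 0 < p by exact: lt_trans p1.
have pB0 : 0 < p - 1 by rewrite subr_gt0.
have q0 : 0 < p / (p - 1) by rewrite divr_gt0.
have pq : p^-1 + (p / (p - 1))^-1 = 1.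
  by field; rewrite !gt_eqF.
have := conjugate_powR z0 (powR_ge0 a (p - 1)) p0 q0 pq.
rewrite -powRrM (_ : (p - 1) * (p / (p - 1)) = p); last by field; rewrite gt_eqF.
rewrite -(ler_pM2l p0).
rewrite (_ : p * (z `^ p / p + _) = z `^ p + (p - 1) * a `^ p); last first.
  by field; rewrite !gt_eqF.
by lra.
Qed.

(** The power mean inequality, by adding up the tangents at the mean of the [x i]. *)
Lemma powR_sum_le (T : finType) (P : pred T) (x : T -> R) :
  (forall i, 0 <= x i) ->
  (\sum_(i | P i) x i) `^ p <= #|P|%:R `^ (p - 1) * \sum_(i | P i) x i `^ p.
Proof.
move=> x0; have p0 : 0 < p by exact: lt_trans p1.
set S := \sum_(i | P i) x i; have S0 : 0 <= S by rewrite sumr_ge0.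
have [P0|Ppos] := posnP #|P|.
  have -> : S = 0.
    by rewrite /S big_pred0// => i; have := card0_eq P0 i.
  by rewrite powR0 ?gt_eqF// mulr_ge0 ?powR_ge0// sumr_ge0// => i _; rewrite powR_ge0.
have N0 : 0 < #|P|%:R :> R by rewrite ltr0n.
set N : R := #|P|%:R; pose a := S / N.
have a0 : 0 <= a by rewrite divr_ge0// ltW.
have Sa : S = N * a by rewrite mulrCA divff ?mulr1// gt_eqF.
rewrite {1}Sa powRM ?(ltW N0)// -(mulr_powRB1 (ltW N0) p0) mulrAC mulrC.
rewrite ler_wpM2l ?powR_ge0//.
apply: (@le_trans _ _ (\sum_(i | P i) (p * a `^ (p - 1) * x i - (p - 1) * a `^ p))).
  rewrite big_split/= -mulr_sumr -/S sumrN sumr_const -[X in _ - X]mulr_natr -/N.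
  by rewrite Sa -(mulr_powRB1 a0 p0); lra.
by apply: ler_sum => i _; exact: powR_tangent.
Qed.

End powR.

(** The sum runs over ordered pairs, which accounts for the factor 2 of [edge_form]. *)
Definition qform (R : realType) (T : finType) (G : rel T) (x : T -> R) : R :=
  \sum_i \sum_(j | G i j) x i * x j.

(** No [p]-th root is taken, hence the exponents [2 / p] below. *)
Definition pnorm (R : realType) (T : finType) (p : R) (x : T -> R) : R :=
  \sum_i `|x i| `^ p.

Section spectral.
Variables (R : realType) (n : nat) (p : R) (G : sgraph 'I_n).
Hypotheses (n0 : (0 < n)%N) (p0 : 0 < p).
Local Notation lam := (pspectral_radius p G).

Lemma edge_form_qform (x : 'rV[R]_n) : edge_form G x = qform G (x 0).
Proof.
rewrite /edge_form /qform.
have -> : \sum_i \sum_(j | G i j) x 0 i * x 0 j =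
    \sum_(i < n) \sum_(j < n | (i < j)%N && G i j) x 0 i * x 0 j +
    \sum_(i < n) \sum_(j < n | (j < i)%N && G i j) x 0 i * x 0 j.
  rewrite -big_split/=; apply: eq_bigr => i _.
  rewrite (bigID (fun j : 'I_n => (i < j)%N))/=; congr (_ + _).
    by apply: eq_bigl => j; rewrite andbC.
  apply: eq_bigl => j; rewrite andbC -leqNgt leq_eqVlt.
  by case: eqVneq => // /val_inj->; rewrite adj_irrefl !andbF.
rewrite mulr_natl mulr2n; congr (_ + _).
rewrite [RHS](exchange_big_dep predT)//=; apply: eq_bigr => i _.
by apply: eq_big => j => [|_]; [rewrite adj_sym | rewrite mulrC].
Qed.

Lemma qformZ (c : R) (x : 'I_n -> R) :
  qform G (fun i => c * x i) = c ^+ 2 * qform G x.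
Proof.
rewrite /qform mulr_sumr; apply: eq_bigr => i _; rewrite mulr_sumr.
by apply: eq_bigr => j _; ring.
Qed.

Lemma pnormZ (c : R) (x : 'I_n -> R) :
  0 <= c -> pnorm p (fun i => c * x i) = c `^ p * pnorm p x.
Proof.
move=> c0; rewrite /pnorm mulr_sumr; apply: eq_bigr => i _.
by rewrite normrM powRM// ger0_norm.
Qed.

Lemma pnorm_ge0 (x : 'I_n -> R) : 0 <= pnorm p x.
Proof. by apply: sumr_ge0 => i _; exact: powR_ge0. Qed.

Lemma qform_le (x : 'I_n -> R) : qform G x <= lam * pnorm p x `^ (2 / p).
Proof.
have [y yS [<- ymax]] := pspectral_radius_max G n0 p0.
have [N0|Nn0] := eqVneq (pnorm p x) 0.
  have x0 i : x i = 0.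
    have /eqP := N0; rewrite psumr_eq0 => [/allP/(_ i)|? _]; last exact: powR_ge0.
    rewrite mem_index_enum => /(_ isT)/implyP/(_ isT)/eqP/powR_eq0_eq0/eqP.
    by rewrite normr_eq0 => /eqP.
  rewrite N0 powR0 ?mulr0; last by rewrite gt_eqF// divr_gt0.
  by rewrite /qform big1// => i _; rewrite big1// => j _; rewrite x0 mul0r.
have Npos : 0 < pnorm p x by rewrite lt_neqAle eq_sym Nn0 pnorm_ge0.
pose c := pnorm p x `^ (- p^-1).
have c0 : 0 < c by rewrite powR_gt0.
have rowE : (\row_i (c * x i)) 0 = (fun i => c * x i).
  by apply/funext => i; rewrite mxE.
have cS : psphere p (\row_i (c * x i)).
  change (\sum_(i < n) `|(\row_j (c * x j)) 0 i| `^ p = 1).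
  rewrite rowE -/(pnorm p (fun i => c * x i)) pnormZ ?ltW// -powRrM mulNr.
  by rewrite mulVf ?gt_eqF// powRN powRr1 ?mulVf// ltW.
have := ymax _ cS; rewrite [X in X <= _]edge_form_qform rowE.
rewrite qformZ -ler_pdivlMl ?exprn_gt0// => /le_trans; apply.
rewrite mulrC le_eqVlt; apply/orP; left; apply/eqP; congr (_ * _).
rewrite -powR_mulrn ?ltW// -powRrM -powRN; congr (_ `^ _).
by rewrite mulNr opprK mulrC.
Qed.

(** Taking absolute values of the entries of a maximizer preserves the norm and cannot decrease the
    form. *)
Lemma spectral_attained : exists x : 'I_n -> R,
  [/\ forall i, 0 <= x i, pnorm p x = 1 & qform G x = lam].
Proof.
have [y yS [<- ymax]] := pspectral_radius_max G n0 p0.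
have y1 : pnorm p (fun i => `|y 0 i|) = 1.
  have <- : \sum_(i < n) `|y 0 i| `^ p = 1 := yS.
  by apply: eq_bigr => i _; rewrite normr_id.
exists (fun i => `|y 0 i|); split=> //.
apply/eqP; rewrite eq_le; apply/andP; split; last first.
  rewrite edge_form_qform; apply: ler_sum => i _; apply: ler_sum => j _.
  by rewrite -normrM ler_norm.
have rowE : (\row_i `|y 0 i|) 0 = (fun i => `|y 0 i|).
  by apply/funext => i; rewrite mxE.
rewrite -rowE -edge_form_qform; apply: ymax.
change (\sum_(i < n) `|(\row_j `|y 0 j|) 0 i| `^ p = 1).
by rewrite rowE.
Qed.

Lemma spectral_ge0 : 0 <= lam.
Proof.
have [x [x0 _ <-]] := spectral_attained.
by apply: sumr_ge0 => i _; apply: sumr_ge0 => j _; rewrite mulr_ge0.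
Qed.

End spectral.

(** * Clique-free graphs *)

(** The vertices outside [A] are kept as isolated ones, so that all subgraphs live on the same type
    and their spectral radii can be compared directly. *)
Definition induced_adj (T : finType) (G : sgraph T) (A : {set T}) : rel T :=
  fun u v => [&& u \in A, v \in A & G u v].

Lemma induced_sym (T : finType) (G : sgraph T) (A : {set T}) :
  symmetric (induced_adj G A).
Proof. by move=> u v; rewrite /induced_adj andbCA adj_sym. Qed.

Lemma induced_irrefl (T : finType) (G : sgraph T) (A : {set T}) :
  irreflexive (induced_adj G A).
Proof. by move=> u; rewrite /induced_adj adj_irrefl !andbF. Qed.

Definition induced (T : finType) (G : sgraph T) (A : {set T}) : sgraph T :=
  SGraph (@induced_sym T G A) (@induced_irrefl T G A).

Lemma qform_induced (R : realType) (T : finType) (G : sgraph T) (A : {set T})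
    (x : T -> R) :
  qform (induced G A) x = \sum_(v in A) x v * \sum_(w in A | G v w) x w.
Proof.
rewrite /qform [RHS]big_mkcond/=; apply: eq_bigr => v _.
case: ifPn => vA; last by rewrite big_pred0// => w; rewrite /= /induced_adj (negbTE vA).
by rewrite mulr_sumr; apply: eq_bigl => w; rewrite /= /induced_adj vA.
Qed.

Lemma multipartite_form (R : comNzRingType) (T : finType) (r : nat) (P : pred T)
    (f : T -> 'I_r) (x : T -> R) :
  \sum_(v | P v) x v * (\sum_(w | P w && (f w != f v)) x w) =
  (\sum_(v | P v) x v) ^+ 2 - \sum_k (\sum_(v | P v && (f v == k)) x v) ^+ 2.
Proof.
have -> : \sum_k (\sum_(v | P v && (f v == k)) x v) ^+ 2 =
    \sum_(v | P v) x v * \sum_(w | P w && (f w == f v)) x w.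
  rewrite (partition_big f xpredT)//=; apply: eq_bigr => k _.
  rewrite expr2 mulr_suml; apply: eq_bigr => v /andP[_ /eqP<-]; congr (_ * _).
rewrite expr2 mulr_suml -sumrB; apply: eq_bigr => v _.
by rewrite -mulrBr [X in _ = _ * (X - _)](bigID (fun w => f w == f v))/= addrAC subrr add0r.
Qed.

(** Degree majorization is applied with the entries of [x] themselves as weights; multiplying by
    [x v] and summing bounds the form by that of a complete [r]-partite graph. *)
Lemma clique_free_form (R : realType) (T : finType) (G : sgraph T) (r : nat)
    (A : {set T}) (x : T -> R) :
  (0 < r)%N -> (forall v, 0 <= x v) ->
  (forall S : {set T}, S \subset A -> clique G S -> #|S| != r.+1) ->
  exists f : T -> 'I_r, qform (induced G A) x <=
    (\sum_(v in A) x v) ^+ 2 - \sum_k (\sum_(v in A | f v == k) x v) ^+ 2.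
Proof.
move=> r0 x0 noK.
have [f [f_lt f_le]] := degree_majorization (adj_sym G) (adj_irrefl G) x0 noK.
pose g v := insubd (Ordinal r0) (f v).
have gE v : v \in A -> val (g v) = f v.
  by move=> vA; rewrite val_insubd f_lt.
exists g; rewrite -multipartite_form qform_induced; apply: ler_sum => v vA.
rewrite ler_wpM2l// (le_trans (f_le v vA))// le_eqVlt; apply/orP; left; apply/eqP.
apply: eq_bigl => w; have [wA|//] := boolP (w \in A).
by rewrite -(inj_eq val_inj) !gE.
Qed.

(** The sum of squared deviations from the mean is nonnegative. *)
Lemma sqr_sum_le (R : realFieldType) (r : nat) (y : 'I_r -> R) :
  (0 < r)%N -> (\sum_k y k) ^+ 2 / r%:R <= \sum_k y k ^+ 2.
Proof.
move=> r0; have rn : r%:R != 0 :> R by rewrite pnatr_eq0 -lt0n.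
set S := \sum_k y k; pose m := S / r%:R.
have : 0 <= \sum_k (y k - m) ^+ 2 by apply: sumr_ge0 => k _; exact: sqr_ge0.
have -> : \sum_k (y k - m) ^+ 2 = \sum_k y k ^+ 2 - 2 * m * S + m ^+ 2 * r%:R.
  under eq_bigr do rewrite sqrrB -mulrnAr.
  rewrite big_split/= big_split/= sumrN sumr_const card_ord -[_ *+ r]mulr_natr.
  congr (_ - _ + _); rewrite -mulr_suml -/S mulr2n; lra.
have -> : 2 * m * S = 2 * (S ^+ 2 / r%:R) by rewrite /m; field.
have -> : m ^+ 2 * r%:R = S ^+ 2 / r%:R by rewrite /m; field.
by lra.
Qed.

Lemma motzkin_straus (R : realType) (T : finType) (G : sgraph T) (r : nat)
    (A : {set T}) (x : T -> R) :
  (0 < r)%N -> (forall v, 0 <= x v) ->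
  (forall S : {set T}, S \subset A -> clique G S -> #|S| != r.+1) ->
  qform (induced G A) x <= (1 - r%:R^-1) * (\sum_(v in A) x v) ^+ 2.
Proof.
move=> r0 x0 noK; have [f] := clique_free_form r0 x0 noK.
move/le_trans; apply.
rewrite mulrBl mul1r lerD2l lerN2 mulrC.
rewrite [X in X ^+ 2](partition_big f xpredT)//=; exact: sqr_sum_le.
Qed.

(** * Balancing the parts of a complete multipartite graph *)

Section transfer.
Variables (R : realType) (p : R).
Hypothesis p1 : 1 < p.

(* Least sum of p-th powers of n numbers with sum y; only meaningful for n = 0
   if y = 0. *)
Definition part_cost (n y : R) := n * (y / n) `^ p.

Lemma part_cost_convex (n1 n2 y1 y2 a : R) :
  0 <= n1 -> 0 <= n2 -> 0 <= y1 -> 0 <= y2 ->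
  (n1 = 0 -> y1 = 0) -> (n2 = 0 -> y2 = 0) -> 0 <= a <= 1 ->
  part_cost ((1 - a) * n1 + a * n2) ((1 - a) * y1 + a * y2) <=
  (1 - a) * part_cost n1 y1 + a * part_cost n2 y2.
Proof.
move=> n10 n20 y10 y20 ny1 ny2 /andP[a0 a1].
have b0 : 0 <= 1 - a by rewrite subr_ge0.
have c0 n y : 0 <= n -> 0 <= part_cost n y by move=> ?; rewrite mulr_ge0 ?powR_ge0.
set n := _ + a * n2; set y := _ + a * y2.
have n0 : 0 <= n by rewrite addr_ge0 ?mulr_ge0.
have y0 : 0 <= y by rewrite addr_ge0 ?mulr_ge0.
have [nz|nz] := eqVneq n 0.
  by rewrite {1}/part_cost nz mul0r; apply: addr_ge0; apply: mulr_ge0 => //; exact: c0.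
pose z := y / n; have z0 : 0 <= z by rewrite divr_ge0.
(* the perspective is the supremum of these linear functions *)
have lin m w : 0 <= m -> 0 <= w -> (m = 0 -> w = 0) ->
    p * z `^ (p - 1) * w - (p - 1) * z `^ p * m <= part_cost m w.
  move=> m0 w0 mw; rewrite /part_cost; have [mz|mz] := eqVneq m 0.
    by rewrite (mw mz) mz mul0r !mulr0 subr0.
  have := ler_wpM2l m0 (powR_tangent p1 z0 (divr_ge0 w0 m0)).
  apply: le_trans; rewrite le_eqVlt; apply/orP; left; apply/eqP.
  by field.
apply: le_trans (lerD (ler_wpM2l b0 (lin _ _ n10 y10 ny1)) (ler_wpM2l a0 (lin _ _ n20 y20 ny2))).
have -> : (1 - a) * (p * z `^ (p - 1) * y1 - (p - 1) * z `^ p * n1) +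
    a * (p * z `^ (p - 1) * y2 - (p - 1) * z `^ p * n2) =
    p * z `^ (p - 1) * y - (p - 1) * z `^ p * n by rewrite /y /n; ring.
have -> : y = n * z by rewrite /z mulrCA divff ?mulr1.
rewrite /part_cost mulrAC divff// mul1r -(mulr_powRB1 z0 (lt_trans ltr01 p1)).
by rewrite le_eqVlt; apply/orP; left; apply/eqP; ring.
Qed.

(* Moves one vertex from a part larger than its target T i to a part smaller
   than its target; the new sizes and sums are convex combinations of the old. *)
Lemma balance_parts (r : nat) (N T : 'I_r -> nat) (y : 'I_r -> R) :
  (\sum_k N k = \sum_k T k)%N -> (forall i j, (T i <= (T j).+1)%N) ->
  (forall k, 0 <= y k) -> (forall k, N k = 0%N -> y k = 0) ->
  exists z : 'I_r -> R, [/\ forall k, 0 <= z k, forall k, T k = 0%N -> z k = 0,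
    \sum_k part_cost (T k)%:R (z k) <= \sum_k part_cost (N k)%:R (y k),
    \sum_k z k = \sum_k y k & \sum_k z k ^+ 2 <= \sum_k y k ^+ 2].
Proof.
(* The induction is on the total excess; truncated subtraction makes parts below their target count
   as 0. *)
move=> + Tbal; have [d] := ubnP (\sum_k (N k - T k)).
elim: d N y => // d IHd N y /ltnSE Nd NT y0 Ny.
have [/existsP[i iN]|/existsPn le] := boolP [exists i, (T i < N i)%N]; last first.
  have NTk k : N k = T k.
    have NTle i : (N i <= T i)%N by rewrite leqNgt le.
    apply/eqP; rewrite eqn_leq NTle leqNgt; apply/negP => lt.
    have : (\sum_k N k < \sum_k T k)%N.
      rewrite (bigD1 k)//= [ltnRHS](bigD1 k)//= -addSn leq_add//.
      by apply: leq_sum => i _.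
    by rewrite NT ltnn.
  exists y; split=> // [k Tk|]; first by apply: Ny; rewrite NTk.
  by under eq_bigr do rewrite -NTk.
have [/existsP[j jN]|/existsPn ge] := boolP [exists j, (N j < T j)%N]; last first.
  exfalso; have : (\sum_k T k < \sum_k N k)%N.
    rewrite (bigD1 i)//= [ltnRHS](bigD1 i)//= -addSn leq_add//.
    by apply: leq_sum => k _; rewrite leqNgt ge.
  by rewrite NT ltnn.
have ij : i != j by apply/eqP => E; rewrite E in iN; have := ltn_trans iN jN; rewrite ltnn.
have Nji : (N j < N i)%N by have := Tbal j i; lia.
pose N' k := if k == i then (N i).-1 else if k == j then (N j).+1 else N k.
pose D : R := (N i)%:R - (N j)%:R.
have D1 : 1 <= D by rewrite /D lerBrDr addrC natr1 ler_nat.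
have D0 : 0 < D by exact: lt_le_trans D1.
(* With this weight, mixing the sizes [N i] and [N j] moves exactly one vertex. *)
pose a := D^-1; have aD : a * D = 1 by rewrite mulVf// gt_eqF.
have a01 : 0 <= a <= 1 by rewrite invr_ge0 ltW//= invf_le1.
pose y' k := if k == i then (1 - a) * y i + a * y j
  else if k == j then a * y i + (1 - a) * y j else y k.
have split2 (F : 'I_r -> R) :
    \sum_k F k = F i + F j + \sum_(k | (k != i) && (k != j)) F k.
  by rewrite (bigD1 i)//= (bigD1 j) ?addrA//= eq_sym.
have split2n (F : 'I_r -> nat) :
    (\sum_k F k = F i + F j + \sum_(k | (k != i) && (k != j)) F k)%N.
  by rewrite (bigD1 i)//= (bigD1 j) ?addnA//= eq_sym.
have N'i : N' i = (N i).-1 by rewrite /N' eqxx.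
have N'j : N' j = (N j).+1 by rewrite /N' eq_sym (negbTE ij) eqxx.
have y'i : y' i = (1 - a) * y i + a * y j by rewrite /y' eqxx.
have y'j : y' j = a * y i + (1 - a) * y j by rewrite /y' eq_sym (negbTE ij) eqxx.
have rest (U : Type) (F : 'I_r -> nat -> R -> U) k :
    (k != i) && (k != j) -> F k (N' k) (y' k) = F k (N k) (y k).
  by rewrite /N' /y' => /andP[/negbTE-> /negbTE->].
have Ni0 : (0 < N i)%N by exact: leq_ltn_trans iN.
have y'0 k : 0 <= y' k.
  have /andP[a0 a1] := a01.
  by rewrite /y'; case: ifP => _; [|case: ifP => _ //]; apply: addr_ge0;
    apply: mulr_ge0 => //; rewrite subr_ge0.
have NiR : (N' i)%:R = (1 - a) * (N i)%:R + a * (N j)%:R.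
  have -> : (N' i)%:R = (N i)%:R - 1 :> R by rewrite N'i -subn1 natrB.
  by rewrite -[X in _ - X = _]aD /D; ring.
have NjR : (N' j)%:R = (1 - a) * (N j)%:R + a * (N i)%:R.
  by rewrite N'j -natr1 -[X in _ + X = _]aD /D; ring.
have [|||k N'k|z [z0 Tz cz sz qz]] := IHd N' y'.
- move: Nd; rewrite !split2n N'i N'j; have jN' : (N j - T j = 0)%N by lia.
  rewrite [X in (_ + X < d)%N](eq_bigr (fun k => N k - T k)%N); last first.
    by move=> k; exact: (rest _ (fun k n _ => n - T k)%N).
  by move/(leq_trans _); apply; rewrite ltn_add2r; clear -jN' iN jN; lia.
- rewrite -NT !split2n N'i N'j [X in (_ + X = _)%N](eq_bigr N); last first.
    by move=> k; exact: (rest _ (fun k n _ => n)).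
  by congr (_ + _)%N; clear -Ni0; lia.
- exact: y'0.
(* Part [i] becomes empty only if [N i = 1] and [N j = 0]; then [a = 1] and its new sum is
   [y j = 0]. *)
- move: N'k; rewrite /N' /y'; case: eqP => [_ Ni|_].
    have N1 : N i = 1%N by lia.
    have Nj0 : N j = 0%N by lia.
    by rewrite (Ny _ Nj0) mulr0 addr0 /a /D N1 Nj0 subr0 invr1 subrr mul0r.
  by case: eqP => // _; exact: Ny.
exists z; split=> //.
- apply: le_trans cz _; rewrite !split2.
  rewrite [X in _ + X <= _](eq_bigr (fun k => part_cost (N k)%:R (y k))); last first.
    by move=> k; exact: (rest _ (fun k n y => part_cost n%:R y)).
  rewrite lerD2r NiR NjR y'i y'j [a * y i + _]addrC.
  have Ny' k : (N k)%:R = 0 :> R -> y k = 0.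
    by move=> /eqP; rewrite pnatr_eq0 => /eqP; exact: Ny.
  have Hi := part_cost_convex (ler0n _ (N i)) (ler0n _ (N j)) (y0 i) (y0 j) (@Ny' i) (@Ny' j) a01.
  have Hj := part_cost_convex (ler0n _ (N j)) (ler0n _ (N i)) (y0 j) (y0 i) (@Ny' j) (@Ny' i) a01.
  by move: (lerD Hi Hj) => /le_trans; apply; lra.
- rewrite sz !split2 y'i y'j; congr (_ + _); first by ring.
  by apply: eq_bigr => k; exact: (rest _ (fun k _ y => y)).
- apply: le_trans qz _; rewrite !split2.
  rewrite [X in _ + X <= _](eq_bigr (fun k => y k ^+ 2)); last first.
    by move=> k; exact: (rest _ (fun k _ y => y ^+ 2)).
  rewrite lerD2r y'i y'j -subr_ge0.
  rewrite (_ : _ - _ = 2 * (a * (1 - a)) * (y i - y j) ^+ 2); last by ring.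
  have /andP[a0 a1] := a01; apply: mulr_ge0; last exact: sqr_ge0.
  by apply: mulr_ge0 => //; apply: mulr_ge0; rewrite ?subr_ge0.
Qed.

End transfer.

(** * Extremality and size of the spectral radius of the Turan graph *)

Section turan.
Variables (R : realType) (r n : nat) (p : R).
Hypotheses (r0 : (0 < r)%N) (n0 : (0 < n)%N) (p1 : 1 < p).

Let p0 : 0 < p. Proof. exact: lt_trans p1. Qed.
Let part (v : 'I_n) : 'I_r := Ordinal (ltn_pmod v r0).

Lemma qform_turan (x : 'I_n -> R) : qform (turan r n) x =
  (\sum_v x v) ^+ 2 - \sum_k (\sum_(v | part v == k) x v) ^+ 2.
Proof.
rewrite -(multipartite_form xpredT)/=; apply: eq_bigr => v _.
rewrite mulr_sumr; apply: eq_bigl => w.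
by rewrite /= /turan_adj -(inj_eq val_inj) eq_sym.
Qed.

Lemma sum_card_fibres (f : 'I_n -> 'I_r) :
  (\sum_k #|[pred v | f v == k]| = n)%N.
Proof.
rewrite -[RHS]card_ord -sum1_card (partition_big f xpredT)//=.
by apply: eq_bigr => k _; rewrite -sum1_card; apply: eq_bigl => v.
Qed.

Lemma card_part (k : 'I_r) :
  #|[pred v | part v == k]| = (n %/ r + (k < n %% r))%N.
Proof.
by rewrite -card_turan_part.
Qed.

(** The maximizer for [G] is recorded only by the sizes and sums of the classes from
    [clique_free_form]. After balancing, spreading the new sums evenly over the Turan parts gives a
    vector of no larger norm, with the same total and no larger sum of squares, so its form is at
    least as large. *)
Lemma spectral_turan (G : sgraph 'I_n) :
  (forall S : {set 'I_n}, clique G S -> #|S| != r.+1) ->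
  pspectral_radius p G <= pspectral_radius p (turan r n).
Proof.
move=> noK; have [x [x0 x1 <-]] := spectral_attained G n0 p0.
have [f f_le] := @clique_free_form R _ G r [set: 'I_n] x r0 x0 (fun S _ => noK S).
pose N k := #|[pred v | f v == k]|; pose T k := #|[pred v | part v == k]|.
pose y k := \sum_(v | f v == k) x v.
have y0 k : 0 <= y k by rewrite sumr_ge0.
have Ny k : N k = 0%N -> y k = 0.
  by move=> Nk; rewrite /y big_pred0// => v; have := card0_eq Nk v.
(* By the power mean inequality, the even distribution within a class has the least norm. *)
have cost_y : \sum_k part_cost p (N k)%:R (y k) <= 1.
  rewrite -[X in _ <= X]x1 /pnorm (partition_big f xpredT)//=; apply: ler_sum => k _.
  rewrite (eq_bigr (fun v => x v `^ p)); last by move=> v _; rewrite ger0_norm.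
  have [Nk|Nk] := posnP (N k).
    by rewrite /part_cost Nk mul0r sumr_ge0// => v _; exact: powR_ge0.
  have Nk0 : 0 < (N k)%:R :> R by rewrite ltr0n.
  rewrite /part_cost powRM// ?invr_ge0//.
  apply: (@le_trans _ _ ((N k)%:R * (((N k)%:R `^ (p - 1) * \sum_(v | f v == k) x v `^ p) *
     (N k)%:R^-1 `^ p))).
    by rewrite ler_wpM2l// ler_wpM2r ?powR_ge0//; exact: powR_sum_le.
  rewrite -powR_inv1// -powRrM mulN1r powRN.
  rewrite [_ * (_ * _ * _)](_ : _ = ((N k)%:R * (N k)%:R `^ (p - 1)) / (N k)%:R `^ p *
    \sum_(v | f v == k) x v `^ p); last by ring.
  by rewrite mulr_powRB1// divff ?mul1r// gt_eqF// powR_gt0.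
have [||z [z0 Tz cz sz qz]] := balance_parts p1 (N := N) (T := T) _ _ y0 Ny.
- by rewrite !sum_card_fibres.
- by move=> i j; rewrite /T !card_part; case: (_ < _)%N; case: (_ < _)%N; lia.
pose z' v := z (part v) / (T (part v))%:R.
(* When [n < r] some parts are empty; there the sum is 0 and [Tz] gives [z k = 0]. *)
have sumw k : \sum_(v | part v == k) z' v = z k.
  rewrite (eq_bigr (fun=> z k / (T k)%:R)); last by move=> v /eqP <-.
  rewrite sumr_const -[#|_|]/(T k) -[_ *+ T k]mulr_natr; have [Tk|Tk] := eqVneq (T k) 0%N.
    by rewrite (Tz _ Tk) !mul0r.
  by rewrite mulfVK// pnatr_eq0.
have sumT : \sum_v z' v = \sum_k z k.
  by rewrite (partition_big part xpredT)//=; apply: eq_bigr => k _; exact: sumw.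
have z'0 v : 0 <= z' v by rewrite divr_ge0.
have normz : pnorm p z' <= 1.
  apply: le_trans cost_y; apply: le_trans cz; rewrite /pnorm.
  rewrite (partition_big part xpredT)//=; apply: ler_sum => k _.
  rewrite (eq_bigr (fun=> (z k / (T k)%:R) `^ p)); last first.
    by move=> v /eqP <-; rewrite ger0_norm.
  by rewrite sumr_const -[#|_|]/(T k) /part_cost mulr_natl.
have GE : qform G x = qform (induced G [set: 'I_n]) x.
  apply: eq_bigr => v _; apply: eq_bigl => u.
  by rewrite /= /induced_adj !inE.
rewrite GE (le_trans f_le)//.
rewrite (eq_bigl xpredT); last by move=> v; rewrite inE.
rewrite (eq_bigr (fun k => y k ^+ 2)); last first.
  by move=> k _; congr (_ ^+ 2); apply: eq_bigl => v; rewrite inE.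
have := qform_le (turan r n) n0 p0 z'.
rewrite qform_turan sumT [X in _ - X <= _](eq_bigr (fun k => z k ^+ 2)); last by move=> k _; rewrite sumw.
have -> : \sum_v x v = \sum_k z k by rewrite sz (partition_big f xpredT).
have lam0 : 0 <= pspectral_radius p (turan r n) by exact: spectral_ge0.
have norm1 : pnorm p z' `^ (2 / p) <= 1.
  apply: le_trans (ge0_ler_powR _ _ _ normz) _; rewrite ?powR1 ?nnegrE ?pnorm_ge0//.
  by rewrite divr_ge0 ?ltW.
move: (ler_wpM2l lam0 norm1) qz; lra.
Qed.

(** Evaluates the form at the all-ones vector; every part size is within 1 of [n / r], so the sum of
    their squares exceeds [n ^ 2 / r] by at most [r]. *)
Lemma spectral_turan_ge :
  (1 - r%:R^-1) * n%:R ^+ 2 - r%:R <= pspectral_radius p (turan r n) * n%:R `^ (2 / p).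
Proof.
have := qform_le (turan r n) n0 p0 (fun=> 1 : R).
have -> : pnorm p (fun _ : 'I_n => 1 : R) = n%:R :> R.
  by rewrite /pnorm normr1 powR1 sumr_const card_ord.
apply: le_trans; rewrite qform_turan sumr_const card_ord mulrBl mul1r.
rewrite -addrA lerD2l -opprD lerN2.
have rn : 0 < r%:R :> R by rewrite ltr0n.
pose T k := #|[pred v | part v == k]|.
rewrite (eq_bigr (fun k => (T k)%:R ^+ 2 : R)); last first.
  by move=> k _; rewrite sumr_const.
pose m : R := n%:R / r%:R.
have sumT : \sum_k (T k)%:R = n%:R :> R by rewrite -natr_sum sum_card_fibres.
have dev k : ((T k)%:R - m) ^+ 2 <= 1 :> R.
  have nE : n%:R = (n %/ r)%:R * r%:R + (n %% r)%:R :> R.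
    by rewrite -natrM -natrD -divn_eq.
  have mE : m = (n %/ r)%:R + (n %% r)%:R / r%:R by rewrite /m nE mulrDl mulfK ?gt_eqF.
  have rem1 : (n %% r)%:R / r%:R <= 1 :> R.
    by rewrite ler_pdivrMr// mul1r ler_nat ltnW// ltn_pmod.
  have rem0 : 0 <= (n %% r)%:R / r%:R :> R by rewrite divr_ge0.
  rewrite -subr_ge0 (_ : _ - _ = (1 - ((T k)%:R - m)) * (1 + ((T k)%:R - m))); last by ring.
  rewrite /T card_part natrD mE; move: rem0 rem1; move: (_ / _ : R) => e e0 e1.
  by case: (_ < _)%N => /=; apply: mulr_ge0; lra.
have : \sum_k ((T k)%:R - m) ^+ 2 <= r%:R :> R.
  apply: le_trans (ler_sum _ (fun k _ => dev k)) _.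
  by rewrite sumr_const card_ord.
have -> : \sum_k ((T k)%:R - m) ^+ 2 = \sum_k (T k)%:R ^+ 2 - 2 * m * n%:R + m ^+ 2 * r%:R.
  under eq_bigr do rewrite sqrrB -mulrnAr.
  rewrite big_split/= big_split/= sumrN sumr_const card_ord -[_ *+ r]mulr_natr.
  by congr (_ - _ + _); rewrite -mulr_suml sumT mulr2n; lra.
have -> : 2 * m * n%:R = 2 * (r%:R^-1 * n%:R ^+ 2) by rewrite /m; field; rewrite gt_eqF.
have -> : m ^+ 2 * r%:R = r%:R^-1 * n%:R ^+ 2 by rewrite /m; field; rewrite gt_eqF.
by lra.
Qed.

End turan.

(** * Vertex deletion *)

Section perturbation.
Variables (R : realType) (n : nat) (p : R) (G : sgraph 'I_n) (x : 'I_n -> R).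
Hypotheses (n0 : (0 < n)%N) (p1 : 1 < p).
Hypotheses (x0 : forall i, 0 <= x i) (x1 : pnorm p x = 1).
Hypothesis xmax : qform G x = pspectral_radius p G.
Local Notation lam := (pspectral_radius p G).

Let p0 : 0 < p. Proof. exact: lt_trans p1. Qed.

Definition update (w : 'I_n) (t : R) (i : 'I_n) := if i == w then t else x i.

Lemma qform_update (w : 'I_n) (t : R) :
  qform G (update w t) = lam + 2 * (t - x w) * \sum_(j | G w j) x j.
Proof.
pose d (i : 'I_n) : R := if i == w then t - x w else 0.
have uE i : update w t i = x i + d i.
  by rewrite /update /d; case: eqP => [->|_]; rewrite ?addr0// addrC subrK.
have sumd (F : 'I_n -> R) : \sum_i d i * F i = (t - x w) * F w.
  rewrite (bigD1 w)//= big1 ?addr0 /d ?eqxx// => i /negbTE->.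
  by rewrite mul0r.
rewrite -xmax /qform.
transitivity (\sum_i \sum_(j | G i j) x i * x j +
  \sum_i d i * (\sum_(j | G i j) x j) + \sum_i x i * (\sum_(j | G i j) d j) +
  \sum_i d i * (\sum_(j | G i j) d j)).
  rewrite -!big_split/=; apply: eq_bigr => i _.
  rewrite !mulr_sumr -!big_split/=; apply: eq_bigr => j _.
  by rewrite !uE; ring.
have -> : \sum_i x i * (\sum_(j | G i j) d j) = \sum_i d i * (\sum_(j | G i j) x j).
  under eq_bigr do rewrite mulr_sumr.
  rewrite (exchange_big_dep xpredT)//=; apply: eq_bigr => i _.
  by rewrite mulr_sumr; apply: eq_big => j; rewrite 1?adj_sym 1?mulrC.
(* The quadratic term vanishes because [G] has no loops. *)
rewrite !sumd [X in _ + _ * X](_ : _ = 0); first by ring.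
by rewrite big1// => j; rewrite /d; case: eqP => // ->; rewrite adj_irrefl.
Qed.

Lemma pnorm_update (w : 'I_n) (t : R) : 0 <= t ->
  pnorm p (update w t) = 1 - x w `^ p + t `^ p.
Proof.
move=> t0; rewrite -x1 /pnorm (bigD1 w)//= [in RHS](bigD1 w)//= /update eqxx.
rewrite !ger0_norm// [x w `^ p + _]addrC addrK addrC; congr (_ + _).
by apply: eq_bigr => i /negbTE->.
Qed.

(** The Lagrange condition for one entry: by [qform_le] the function [phi] of the entry at [w] has
    its minimum over positive [t] at [x w], where its derivative must vanish. *)
Lemma eigen_equation (w : 'I_n) : 0 < x w ->
  \sum_(j | G w j) x j = lam * x w `^ (p - 1).
Proof.
move=> xw; set d := \sum_(j | G w j) x j.
have xwp1 : 0 <= 1 - x w `^ p.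
  rewrite subr_ge0 -x1 /pnorm (bigD1 w)//= ger0_norm// lerDl.
  by rewrite sumr_ge0// => i _; exact: powR_ge0.
pose h (t : R) : R := 1 - x w `^ p + t `^ p.
have h0 (t : R) : 0 < t -> 0 < h t by move=> t0; rewrite ltr_wpDl// powR_gt0.
pose phi (t : R) : R := lam * h t `^ (2 / p) - 2 * d * t.
have dphi (t : R) : 0 < t -> is_derive t (1 : R) phi
    (lam * ((p * t `^ (p - 1)) * (2 / p * h t `^ (2 / p - 1))) - 2 * d).
  move=> t0.
  have dh : is_derive t (1 : R) h (p * t `^ (p - 1)).
    have D := is_derive1_powR p t0.
    have E := is_deriveD (is_derive_cst (1 - x w `^ p) t 1) D.
    by apply: is_derive_eq E _; rewrite add0r.
  have Dh := is_derive1_powR (2 / p) (h0 t t0).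
  have C := is_derive1_comp Dh dh.
  have CZ := is_deriveZ lam C.
  have I := is_deriveZ (2 * d) (is_derive_id t (1 : R)).
  apply: is_derive_eq (is_deriveB CZ I) _.
  rewrite /GRing.scale/=; ring.
have min (t : R) : 0 < t -> phi (x w) <= phi t.
  move=> t0; have := qform_le G n0 p0 (update w t).
  rewrite qform_update (pnorm_update _ (ltW t0)) -/(h t) -/d.
  have : h (x w) `^ (2 / p) = 1 by rewrite /h subrK powR1.
  by rewrite /phi => ->; lra.
have Z := @derive1_at_min R phi 0 (x w + 1) (x w).
have {Z} [_ Z] : is_derive (x w) (1 : R) phi 0.
  apply: Z => [|t||t].
  - by rewrite addr_ge0.
  - by rewrite in_itv/= => /andP[t0 _]; have [] := dphi t t0.
  - by rewrite in_itv/= xw ltrDl ltr01.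
  - by rewrite in_itv/= => /andP[/min].
have [_ Y] := dphi _ xw.
move: Y; rewrite Z /h subrK powR1 mulr1 => Y.
have : p * (2 / p) = 2 by field; rewrite gt_eqF.
move=> E.
have F : lam * (p * x w `^ (p - 1) * (2 / p)) = 2 * (lam * x w `^ (p - 1)).
  by transitivity (p * (2 / p) * (lam * x w `^ (p - 1))); [ring | rewrite E].
by move: Y; rewrite F; lra.
Qed.

End perturbation.

(** * Logarithmic estimates for one deletion *)

Lemma ln_ge_1BV (R : realType) (x : R) : 0 < x -> 1 - x^-1 <= ln x.
Proof.
move=> x0; have := @le_ln1Dx R (x^-1 - 1).
rewrite (_ : 1 + _ = x^-1); last by ring.
rewrite lnV ?posrE// => h.
have : - ln x <= x^-1 - 1 by apply: h; rewrite ltrBrDr addNr invr_gt0.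
by lra.
Qed.

(** With [M = #|A|] and [2 - 2q = 2 / p], this says that the spectral radius after a deletion stays
    above its threshold. In logarithms and units of [q * theta * z], where [z = 1 / (M - 1)]: the
    bound on [s * M] gains 3/2 ([lower]), the [theta] in the exponent costs 1 ([upper]), and the
    second-order term costs 1/2 ([err]). *)
Lemma deletion_rate (R : realType) (q theta s M : R) :
  0 < q < 1 -> 0 < theta <= 1 -> 0 <= s -> s * M <= 1 - theta -> 4 <= M ->
  8 <= 3 * q * theta * (M - 1) ->
  (1 - s) `^ (2 - 2 * q) * ((M - 1) / M) `^ (q * (2 - theta)) <= 1 - 2 * s.
Proof.
move=> /andP[q0 q1] /andP[t0 t1] s0 sM M4 big.
have M0 : 0 < M by lra.
pose z := (M - 1)^-1; have M1 : 0 < M - 1 by lra.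
have z0 : 0 < z by rewrite invr_gt0.
have zM : z * (M - 1) = 1 by rewrite mulVf// gt_eqF.
have z2 : z <= 1 / 3 by rewrite /z -[leRHS]invrK lef_pV2 ?posrE//; lra.
have zq : 8 * z <= 3 * q * theta.
  by have := ler_wpM2l (ltW z0) big; rewrite [z * (_ * (M - 1))]mulrCA zM; lra.
have qt1 : q * theta <= 1 by rewrite mulr_ile1// ltW.
have tz : theta * z <= 1 / 3.
  by have := ler_wpM2l (ltW z0) t1; lra.
have s1 : s * M <= 1 by lra.
have s3 : s <= 1 / 3.
  by have := ler_wpM2l s0 M4; lra.
have s1' : 0 < 1 - s by lra.
have sz : s / (1 - s) <= z.
  by rewrite ler_pdivrMr// -(ler_pM2r M1) mulrAC zM; lra.
set e := s / (1 - s) in sz.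
have e0 : 0 <= e by rewrite divr_ge0// ltW.
have split_s : 1 - 2 * s = (1 - s) ^+ 2 * (1 - e ^+ 2).
  by rewrite /e; field; rewrite gt_eqF.
have ez2 : e ^+ 2 <= z ^+ 2 by rewrite lerXn2r ?nnegrE// ltW.
have z24 : z ^+ 2 <= z / 3 by have := ler_wpM2l (ltW z0) z2; lra.
have e21 : 0 < 1 - e ^+ 2 by lra.
rewrite -ler_ln ?posrE ?mulr_gt0 ?powR_gt0 ?divr_gt0//; last by lra.
rewrite split_s !lnM ?posrE ?powR_gt0 ?exprn_gt0 ?divr_gt0// !ln_powR.
set L := ln (1 - s); set L1 := ln ((M - 1) / M).
have lower : theta * z * (3 / 4) <= L - L1.
  rewrite /L /L1 -ln_div ?posrE ?divr_gt0//.
  have h1 : 1 + theta * z <= (1 - s) / ((M - 1) / M).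
    rewrite invf_div mulrA ler_pdivlMr// mulrDl -mulrA zM; lra.
  apply: (@le_trans _ _ (ln (1 + theta * z))); last first.
    by rewrite ler_ln ?posrE ?(lt_le_trans _ h1)// ?addr_gt0 ?mulr_gt0.
  have p1 : 0 < 1 + theta * z by rewrite addr_gt0 ?mulr_gt0.
  apply: le_trans (ln_ge_1BV p1).
  have -> : 1 - (1 + theta * z)^-1 = theta * z / (1 + theta * z).
    by field; rewrite gt_eqF.
  rewrite ler_pdivlMr//; have := mulr_gt0 t0 z0 => tz0.
  have := ler_wpM2l (ltW tz0) tz; lra.
have upper : - L1 <= z.
  have -> : - L1 = ln (1 + z).
    rewrite /L1 -lnV ?posrE ?divr_gt0//; congr ln; rewrite /z; field.
    by rewrite !gt_eqF.
  by apply: le_ln1Dx; apply: lt_trans z0; lra.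
(* The hypothesis [big] gives [e ^ 2 <= z ^ 2 <= 3/8 * q * theta * z], while [1 - e ^ 2 >= 3/4]. *)
have err : - (q * theta * z / 2) <= ln (1 - e ^+ 2).
  apply: le_trans (ln_ge_1BV e21).
  have -> : 1 - (1 - e ^+ 2)^-1 = - (e ^+ 2 / (1 - e ^+ 2)) by field; rewrite gt_eqF.
  rewrite lerN2 ler_pdivrMr//.
  have z1 : z ^+ 2 <= 1 / 4 by have := ler_wpM2l (ltW z0) z2; lra.
  have c0 : 0 <= q * theta * z by rewrite !mulr_ge0// ltW.
  have c1 : 8 * z ^+ 2 <= 3 * (q * theta * z).
    by have := ler_wpM2l (ltW z0) zq; lra.
  have := ler_wpM2l c0 (_ : e ^+ 2 <= 1 / 4); rewrite (le_trans ez2)// => /(_ isT).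
  lra.
have U := ler_wpM2l (_ : 0 <= q * theta) upper.
have {}U := U (mulr_ge0 (ltW q0) (ltW t0)).
have W := ler_wpM2l (ltW q0) lower.
lra.
Qed.

Section deletion.
Variables (R : realType) (n : nat) (p : R) (G : sgraph 'I_n) (A : {set 'I_n}).
Hypotheses (n0 : (0 < n)%N) (p1 : 1 < p).
Let p0 : 0 < p. Proof. exact: lt_trans p1. Qed.
Local Notation H := (induced G A).
Local Notation lam := (pspectral_radius p H).

(** A positive entry at an isolated vertex could be set to 0, which keeps the form but lowers the
    norm. *)
Lemma induced_attained : 0 < lam -> exists x : 'I_n -> R,
  [/\ forall i, 0 <= x i, pnorm p x = 1, qform H x = lam &
      forall v, v \notin A -> x v = 0].
Proof.
move=> lam0; have [x [x0 x1 xmax]] := spectral_attained H n0 p0.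
exists x; split=> // v vA; apply/eqP; rewrite eq_le x0 andbT leNgt; apply/negP => xv.
pose y := update x v 0.
have yE : qform H y = lam.
  rewrite (qform_update xmax) big_pred0 ?mulr0 ?addr0// => w.
  by rewrite /= /induced_adj (negbTE vA).
have := qform_le H n0 p0 y; rewrite yE (pnorm_update x0 x1)// powR0 ?gt_eqF// addr0.
have xvp : 0 < x v `^ p by rewrite powR_gt0.
have xv1 : 0 <= 1 - x v `^ p.
  rewrite -[1 - _]addr0 -[X in _ + X](@powR0 _ p) ?gt_eqF//.
  by rewrite -(pnorm_update x0 x1)// pnorm_ge0.
rewrite -{1}[lam]mulr1 ler_pM2l// leNgt => /negP; apply.
rewrite -[ltRHS](_ : 1 `^ (2 / p) = 1); last by rewrite powR1.
by rewrite gt0_ltr_powR ?nnegrE ?divr_gt0//; lra.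
Qed.

(** The deleted vertex [u] has the least entry of the eigenvector, not the least degree; the low
    degree of [w] only serves to show that this entry is small. Setting it to 0 turns the form into
    [lam * (1 - 2 * s)] and the norm into [1 - s]. *)
Lemma vertex_deletion (beta theta : R) (w : 'I_n) :
  0 < beta <= 1 -> 0 < theta <= 1 -> beta <= (beta + theta) * (1 - theta) ->
  (beta + theta) * #|A|%:R `^ (2 * (1 - p^-1)) <= lam ->
  w \in A -> #|[set v in A | G w v]|%:R <= beta * #|A|%:R ->
  exists u, exists s, [/\ u \in A, 0 <= s, s * #|A|%:R <= 1 - theta &
    lam * (1 - 2 * s) <=
    pspectral_radius p (induced G (A :\ u)) * (1 - s) `^ (2 / p)].
Proof.
move=> /andP[b0 b1] /andP[t0 t1] bt lam_ge wA deg_w.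
have m0 : 0 < #|A|%:R :> R by rewrite ltr0n; apply/card_gt0P; exists w.
set m : R := #|A|%:R in lam_ge deg_w m0 *.
have lam0 : 0 < lam.
  by apply: lt_le_trans lam_ge; rewrite mulr_gt0 ?powR_gt0 ?addr_gt0.
have [x [x0 x1 xmax xA]] := induced_attained lam0.
have [u uA umin] : exists2 u, u \in A & forall v, v \in A -> x u <= x v.
  by case: (Order.TotalTheory.arg_minP x wA) => u uA umin; exists u.
pose s := x u `^ p.
have s0 : 0 <= s by exact: powR_ge0.
have pnormA (N : {set 'I_n}) : N \subset A ->
    \sum_(v in N) x v `^ p + (m - #|N|%:R) * s <= 1.
  move=> NA; rewrite -[leRHS]x1 /pnorm [leRHS](bigID (mem N))/=; apply: lerD.
    by apply: ler_sum => v _; rewrite ger0_norm.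
  have -> : m - #|N|%:R = #|A :\: N|%:R.
    by rewrite cardsD (setIidPr NA) natrB// subset_leq_card.
  rewrite mulr_natl -sumr_const big_mkcond/= [leRHS]big_mkcond/=.
  apply: ler_sum => v _; rewrite inE; case: (v \in N) => //=.
  case: ifP => [vA|_]; last exact: powR_ge0.
  by rewrite ger0_norm// ge0_ler_powR ?nnegrE ?umin// ltW.
exists u, s; split=> //.
- have [xu|xu] := eqVneq (x u) 0.
    by rewrite /s xu powR0 ?gt_eqF// mul0r subr_ge0.
  have xu0 : 0 < x u by rewrite lt_neqAle eq_sym xu x0.
  pose N := [set v in A | G w v].
  have NA : N \subset A by apply/subsetP => v; rewrite inE => /andP[].
  have eig := eigen_equation n0 p1 x0 x1 xmax (lt_le_trans xu0 (umin w wA)).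
  have dN : \sum_(j | H w j) x j = \sum_(j in N) x j.
    by apply: eq_bigl => j; rewrite inE /= /induced_adj wA.
  rewrite dN in eig.
  have xu_xw : x u `^ (p - 1) <= x w `^ (p - 1).
    by rewrite ge0_ler_powR ?nnegrE ?umin// subr_ge0 ltW.
  (* The eigenvector equation at [w] and the power mean inequality over its neighbours, whose [p]-th
     powers leave at least [s] to each of the other [m - #|N|] vertices of [A]. *)
  have main : lam `^ p * s `^ (p - 1) <= (beta * m) `^ (p - 1) * (1 - (1 - beta) * (m * s)).
    have -> : lam `^ p * s `^ (p - 1) = (lam * x u `^ (p - 1)) `^ p.
      by rewrite powRM ?powR_ge0 ?ltW// /s powRAC.
    apply: (@le_trans _ _ ((\sum_(j in N) x j) `^ p)).
      rewrite eig ge0_ler_powR ?nnegrE ?mulr_ge0 ?powR_ge0 ?(ltW lam0) ?(ltW p0)//.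
      by rewrite ler_wpM2l// ltW.
    apply: le_trans (powR_sum_le p1 (mem N) x0) _.
    rewrite (_ : #|_| = #|N|); last by apply: eq_card.
    apply: ler_pM; rewrite ?powR_ge0//.
    - by apply: sumr_ge0 => i _; exact: powR_ge0.
    - rewrite ge0_ler_powR ?nnegrE//; first by rewrite subr_ge0 ltW.
      by rewrite mulr_ge0// ltW.
    - have := pnormA N NA; have := ler_wpM2r s0 deg_w.
      rewrite -/N => h1 h2; lra.
  (* Otherwise [low] and [main] give [beta + theta <= 1 - (1 - beta) * (1 - theta)], which is false
     by the margin [beta * theta]. *)
  rewrite leNgt; apply/negP => big.
  have ms : 1 - theta <= m * s by rewrite mulrC ltW.
  have lam_p : ((beta + theta) * m `^ (2 * (1 - p^-1))) `^ p <= lam `^ p.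
    rewrite ge0_ler_powR ?nnegrE ?mulr_ge0 ?powR_ge0 ?addr_ge0//; exact: ltW.
  have lamE : ((beta + theta) * m `^ (2 * (1 - p^-1))) `^ p =
      (beta + theta) * (beta + theta) `^ (p - 1) * (m `^ (p - 1) * m `^ (p - 1)).
    rewrite powRM ?powR_ge0 ?addr_ge0 ?(ltW b0) ?(ltW t0)// -powRrM.
    rewrite mulr_powRB1 ?addr_ge0 ?(ltW b0) ?(ltW t0)//; congr (_ * _).
    rewrite -powRD ?(gt_eqF m0) ?implybT//; congr (_ `^ _); field.
    by rewrite gt_eqF.
  have low : (beta + theta) * (beta * m) `^ (p - 1) <= lam `^ p * s `^ (p - 1).
    apply: (@le_trans _ _ (((beta + theta) * m `^ (2 * (1 - p^-1))) `^ p * s `^ (p - 1))); last first.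
      by rewrite ler_wpM2r ?powR_ge0.
    rewrite lamE -!mulrA ler_pM2l ?addr_gt0//.
    rewrite (_ : (beta + theta) `^ (p - 1) * _ =
       ((beta + theta) * (m * s) * m) `^ (p - 1)); last first.
      have bt0 : 0 <= beta + theta by rewrite addr_ge0 ?ltW.
      have ms0 : 0 <= m * s by rewrite mulr_ge0// ltW.
      by rewrite (powRM _ (mulr_ge0 bt0 ms0) (ltW m0)) (powRM _ bt0 ms0) (powRM _ (ltW m0) s0); ring.
    have bt0 : 0 <= beta + theta by rewrite addr_ge0 ?ltW.
    apply: ge0_ler_powR; rewrite ?nnegrE.
    - by rewrite subr_ge0 ltW.
    - by rewrite mulr_ge0 ?ltW.
    - by rewrite !mulr_ge0// ltW.
    - by rewrite ler_wpM2r ?(ltW m0)// (le_trans bt)// ler_wpM2l.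
  have bm0 : 0 < (beta * m) `^ (p - 1) by rewrite powR_gt0 ?mulr_gt0.
  have := le_trans low main; rewrite mulrC ler_pM2l//.
  have := ler_wpM2l (_ : 0 <= 1 - beta) ms; rewrite subr_ge0 => /(_ b1).
  have := mulr_gt0 b0 t0; lra.
- pose y := update x u 0.
  have yE : qform H y = lam * (1 - 2 * s).
    (* The eigenvector equation requires a positive entry; if [x u = 0], then [s = 0] and nothing
       changes. *)
    rewrite (qform_update xmax); have [xu|xu] := eqVneq (x u) 0.
      by rewrite /s xu powR0 ?gt_eqF// subr0; ring.
    have xu0 : 0 < x u by rewrite lt_neqAle eq_sym xu x0.
    rewrite (eigen_equation n0 p1 x0 x1 xmax xu0) /s -(mulr_powRB1 (x0 u) p0); ring.
  have yE' : qform H y = qform (induced G (A :\ u)) y.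
    rewrite !qform_induced [RHS]big_mkcond/= big_mkcond/=; apply: eq_bigr => v _.
    rewrite !inE; have [->|vu] := eqVneq v u.
      by rewrite /= /y /update eqxx mul0r; case: ifP.
    case: ifP => //= vA; congr (_ * _).
    rewrite big_mkcond/= [RHS]big_mkcond/=; apply: eq_bigr => z _.
    rewrite !inE; have [->|//] := eqVneq z u.
    by rewrite /y /update eqxx; case: ifP.
  rewrite -yE yE'; have := qform_le (induced G (A :\ u)) n0 p0 y.
  by rewrite (pnorm_update x0 x1)// powR0 ?gt_eqF// addr0.
Qed.

End deletion.

(** * Assembly *)

Section dense_subset.
Variables (R : realType) (n r : nat) (p c : R) (G : sgraph 'I_n).
Hypotheses (r2 : (2 <= r)%N) (p1 : 1 < p) (c0 : 0 < c).
Local Notation q := (1 - p^-1).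
Local Notation L := (ln (n%:R : R)).
Local Notation lam A := (pspectral_radius p (induced G A)).

Let p0 : 0 < p. Proof. exact: lt_trans p1. Qed.
Let r0 : (0 < r)%N. Proof. exact: ltnW. Qed.

Lemma sum_le_powR (A : {set 'I_n}) (x : 'I_n -> R) :
  (forall i, 0 <= x i) -> pnorm p x = 1 ->
  (\sum_(v in A) x v) ^+ 2 <= #|A|%:R `^ (2 * q).
Proof.
move=> x0 x1; set S := \sum_(v in A) x v.
have S0 : 0 <= S by rewrite sumr_ge0.
have Sp : S `^ p <= #|A|%:R `^ (p - 1).
  apply: le_trans (powR_sum_le p1 (mem A) x0) _.
  rewrite (_ : #|_| = #|A|); last by apply: eq_card.
  rewrite ler_piMr ?powR_ge0// -[leRHS]x1 /pnorm [leRHS](bigID (mem A))/=.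
  rewrite (eq_bigr (fun i => `|x i| `^ p)); last by move=> i _; rewrite ger0_norm.
  by rewrite lerDl sumr_ge0// => i _; exact: powR_ge0.
have -> : S ^+ 2 = (S `^ p) `^ (2 / p).
  by rewrite -powRrM mulrCA divff ?gt_eqF// mulr1 powR_mulrn.
have -> : 2 * q = (p - 1) * (2 / p) by field; rewrite gt_eqF.
rewrite [leRHS]powRrM ge0_ler_powR ?nnegrE ?powR_ge0//.
by rewrite divr_ge0// ltW.
Qed.

Hypotheses (HL : 2 <= c * (q * L)) (Hc : 64 * c * r%:R ^+ 5 <= 1).
Hypothesis hG : pspectral_radius p (turan r n) < pspectral_radius p G.
Local Notation eps := (r%:R ^- 4 : R).
Local Notation theta := (eps / 2).
Local Notation beta := (1 - r%:R^-1 - eps : R).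

Lemma dense_subset : exists A S : {set 'I_n},
  [/\ L / 2 <= ln (#|A|%:R : R),
    forall w, w \in A -> beta * #|A|%:R <= #|[set v in A | G w v]|%:R,
    S \subset A, clique G S & #|S| = r.+1].
Proof.
have rho2 : 2 <= r%:R :> R by rewrite ler_nat.
have rho0 : 0 < r%:R :> R by rewrite ltr0n.
have pV : 0 < p^-1 < 1 by rewrite invr_gt0 p0 invf_lt1.
have q01 : 0 < q < 1 by move: pV => /andP[? ?]; apply/andP; split; lra.
have /andP[q0 q1] := q01.
have qL0 : 0 < q * L.
  by rewrite -(pmulr_rgt0 _ c0); apply: lt_le_trans HL.
have L0 : 0 < L by rewrite -(pmulr_rgt0 _ q0).
have n0 : (0 < n)%N by rewrite lt0n; apply/eqP => E; move: L0; rewrite E ln0 ?ltxx.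
have n0R : 0 < n%:R :> R by rewrite ltr0n.
have qL_big : 128 * r%:R ^+ 5 <= q * L.
  have h1 := ler_wpM2r (ltW qL0) Hc.
  have h2 := ler_wpM2l (_ : 0 <= 64 * r%:R ^+ 5 :> R) HL.
  have {}h2 := h2 (mulr_ge0 (ler0n _ _) (exprn_ge0 _ (ltW rho0))).
  by move: h1 h2; lra.
have qL_L : q * L <= L by rewrite ler_piMl ?ltW.
have L_n : L < n%:R by exact: ln_sublinear.
have rho5 : 32 <= r%:R ^+ 5 :> R by rewrite -natrX ler_nat (@leq_exp2r 2 r 5).
have e0 : 0 < eps by rewrite invr_gt0 exprn_gt0.
have t0 : 0 < theta by rewrite divr_gt0.
have tE : theta * (2 * r%:R ^+ 4) = 1.
  by field; rewrite gt_eqF// exprn_gt0.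
have rr : r%:R * r%:R^-1 = 1 :> R by rewrite divff// gt_eqF.
have rV0 : 0 < r%:R^-1 :> R by rewrite invr_gt0.
have rV2 : r%:R^-1 <= 1 / 2 :> R.
  by have := ler_wpM2l (ltW rV0) rho2; rewrite mulrC [_ * r%:R]mulrC rr; lra.
have e16 : eps <= 1 / 16.
  have : 16 <= r%:R ^+ 4 :> R by rewrite -natrX ler_nat (@leq_exp2r 2 r 4).
  move=> /(ler_wpM2l (ltW e0)); rewrite mulVf; first by lra.
  by rewrite gt_eqF// exprn_gt0.
have beta0 : 0 < beta by lra.
pose alpha : R := 1 - r%:R^-1 - r%:R / n%:R ^+ 2.
have alpha_ge : beta + theta <= alpha.
  rewrite /alpha; suff : r%:R / n%:R ^+ 2 <= theta by lra.
  rewrite ler_pdivrMr ?exprn_gt0//.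
  have n1 : 2 * r%:R ^+ 5 <= n%:R ^+ 2 :> R.
    have n_1 : 1 <= n%:R :> R by rewrite ler1n.
    have := ler_wpM2l (ltW n0R) n_1; rewrite mulr1 -expr2; lra.
  have := ler_wpM2l (ltW t0) n1.
  have -> : theta * (2 * r%:R ^+ 5) = r%:R * (theta * (2 * r%:R ^+ 4)) by ring.
  by rewrite tE mulr1.
have alpha3 : 1 / 3 <= alpha by lra.
have alpha0 : 0 < alpha by lra.
pose lamG := pspectral_radius p G.
have lamG_ge : alpha * n%:R `^ (2 * q) <= lamG.
  have npos : 0 < n%:R `^ (2 / p) :> R by rewrite powR_gt0.
  have h := spectral_turan_ge r0 n0 p1.
  rewrite -(ler_pM2r npos) -mulrA.
  have -> : n%:R `^ (2 * q) * n%:R `^ (2 / p) = n%:R ^+ 2 :> R.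
    rewrite -powRD ?(gt_eqF n0R) ?implybT//.
    have -> : 2 * q + 2 / p = 2%:R by ring.
    by rewrite powR_mulrn ?ltW.
  have -> : alpha * n%:R ^+ 2 = (1 - r%:R^-1) * n%:R ^+ 2 - r%:R.
    by rewrite /alpha; field; rewrite !gt_eqF.
  by apply: le_trans h _; rewrite ler_wpM2r ?(ltW npos)//; exact: ltW hG.
have lamG0 : 0 < lamG by apply: lt_le_trans lamG_ge; rewrite mulr_gt0 ?powR_gt0.
(* The exponent is slightly below [2q], so along sets satisfying [P] the guaranteed ratio of [lam A]
   to [#|A| ^ (2q)] grows as the set shrinks. *)
pose k := q * (2 - theta).
pose P (A : {set 'I_n}) :=
  (0 < #|A|)%N && (lamG * (#|A|%:R / n%:R) `^ k <= lam A).
have PT : P [set: 'I_n].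
  rewrite /P cardsT card_ord n0/= divff ?gt_eqF// powR1 mulr1.
  have [x [x0 x1 xE]] := spectral_attained G n0 p0.
  have := qform_le (induced G [set: 'I_n]) n0 p0 x; rewrite x1 powR1 mulr1.
  apply: le_trans; rewrite /lamG -xE le_eqVlt; apply/orP; left; apply/eqP.
  apply: eq_bigr => v _; apply: eq_bigl => u.
  by rewrite /= /induced_adj !inE.
case: (arg_minnP (fun A : {set 'I_n} => #|A|) PT) => A /andP[A0 lamA] Amin.
have m0 : 0 < #|A|%:R :> R by rewrite ltr0n.
have mn : (#|A| <= n)%N by rewrite -[leqRHS]card_ord max_card.
set m : R := #|A|%:R in lamA m0 *.
have mnR : m <= n%:R by rewrite ler_nat.
have lamA_upper C : 0 < C -> lam A <= C * m `^ (2 * q) ->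
    q * theta * (L - ln m) <= ln C - ln alpha.
  move=> C0 ub.
  have : ln (alpha * n%:R `^ (2 * q) * (m / n%:R) `^ k) <= ln (C * m `^ (2 * q)).
    rewrite ler_ln ?posrE ?mulr_gt0 ?powR_gt0 ?divr_gt0//.
    apply: le_trans ub; apply: le_trans lamA.
    by rewrite ler_wpM2r ?powR_ge0.
  rewrite !lnM ?posrE ?mulr_gt0 ?powR_gt0 ?divr_gt0//.
  by rewrite !ln_powR ln_div ?posrE// /k; lra.
have lam_att := spectral_attained (induced G A) n0 p0.
(* For [C = 1] the bound gives [q * theta * (L - ln m) <= - ln alpha <= 2 <= c * q * L], and [c] is
   small against [theta]. *)
have lnm : L / 2 <= ln m.
  have := lamA_upper 1 ltr01; rewrite ln1 mul1r => /(_ _) h.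
  have {}h : q * theta * (L - ln m) <= 0 - ln alpha.
    apply: h; have [x [x0 x1 <-]] := lam_att.
    apply: le_trans (sum_le_powR A x0 x1).
    rewrite qform_induced expr2 mulr_suml; apply: ler_sum => v _.
    rewrite ler_wpM2l// [leRHS](bigID (G v))/= lerDl.
    by rewrite sumr_ge0.
  have la : - ln alpha <= 2.
    have := ln_ge_1BV alpha0; have : alpha^-1 <= 3.
      by rewrite -[leRHS]invrK lef_pV2 ?posrE//; lra.
    lra.
  have h2 : theta * (L - ln m) <= c * L.
    by rewrite -(ler_pM2l q0); move: h la HL; lra.
  have r4 : 0 <= 2 * r%:R ^+ 4 :> R by rewrite mulr_ge0 ?exprn_ge0 ?ltW.
  have := ler_wpM2l r4 h2; rewrite mulrA [_ * theta]mulrC tE mul1r.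
  have c4 : 4 * c * r%:R ^+ 4 <= 1.
    apply: le_trans Hc; rewrite (exprS _ 4).
    have -> : 64 * c * (r%:R * r%:R ^+ 4) = 4 * c * r%:R ^+ 4 * (16 * r%:R) by ring.
    by rewrite ler_peMr ?mulr_ge0 ?exprn_ge0 ?(ltW c0) ?(ltW rho0)//; lra.
  have := ler_wpM2r (ltW L0) c4; lra.
have m_big : L / 2 <= m - 1.
  have := expR_ge1Dx (ln m); rewrite lnK ?posrE//; lra.
have min_deg w : w \in A -> beta * m <= #|[set v in A | G w v]|%:R.
  move=> wA; rewrite leNgt; apply/negP => /ltW deg_w.
  have bt1 : beta + theta <= 1 by lra.
  have [||||u [s [uA s0 sm del]]] := vertex_deletion n0 p1 (beta := beta)
      (theta := theta) (G := G) (A := A) (w := w) _ _ _ _ wA deg_w.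
  - by apply/andP; split; lra.
  - by apply/andP; split; lra.
  - have : 0 <= theta * (1 - (beta + theta)) by rewrite mulr_ge0 ?(ltW t0)// subr_ge0.
    lra.
  (* Since [m <= n] and [k <= 2q], raising the exponent of [m / n] to [2q] only decreases the bound,
     and the powers of [n] cancel. *)
  - apply: le_trans lamA.
    apply: (@le_trans _ _ (alpha * n%:R `^ (2 * q) * (m / n%:R) `^ k)); last first.
      by rewrite ler_wpM2r ?powR_ge0.
    apply: (@le_trans _ _ (alpha * n%:R `^ (2 * q) * (m / n%:R) `^ (2 * q))).
      rewrite -mulrA -powRM ?divr_ge0 ?(ltW m0) ?(ltW n0R)//.
      rewrite [n%:R * _]mulrCA divff ?gt_eqF// mulr1.
      by rewrite ler_wpM2r ?powR_ge0.
    rewrite ler_wpM2l ?mulr_ge0 ?powR_ge0 ?(ltW alpha0)//.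
    apply: ger_powR; first by rewrite divr_gt0//= ler_pdivrMr// mul1r.
    rewrite /k; have := mulr_gt0 q0 t0; lra.
  have m4 : 4 <= m by lra.
  have rate : (1 - s) `^ (2 - 2 * q) * ((m - 1) / m) `^ (q * (2 - theta)) <= 1 - 2 * s.
    apply: deletion_rate => //; first by apply/andP; split; lra.
    have h1 : 64 * r%:R <= q * theta * L.
      have := ler_wpM2l (ltW t0) qL_big.
      have -> : theta * (128 * r%:R ^+ 5) = 64 * r%:R * (theta * (2 * r%:R ^+ 4)) by ring.
      by rewrite tE mulr1; lra.
    have := ler_wpM2l (mulr_ge0 (ltW q0) (ltW t0)) m_big; lra.
  have pq : 2 - 2 * q = 2 / p by ring.
  have s1 : 0 < 1 - s.
    by have := ler_wpM2l s0 m4; lra.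
  have sp : 0 < (1 - s) `^ (2 / p) by rewrite powR_gt0.
  have cA : #|A| = #|A :\ u|.+1 by rewrite (cardsD1 u) uA.
  have mE : #|A :\ u|%:R = m - 1 by rewrite /m cA -natr1 addrK.
  have lam0 : 0 <= lam A by exact: spectral_ge0.
  (* The threshold drops by the factor [((m - 1) / m) ^ k], which [rate] compares with the loss in
     [del]. *)
  have PA' : P (A :\ u).
    rewrite /P; apply/andP; split; first by rewrite -(ltr_nat R) mE; lra.
    rewrite mE (_ : (m - 1) / n%:R = m / n%:R * ((m - 1) / m)); last first.
      by field; rewrite !gt_eqF.
    rewrite powRM ?divr_ge0 ?(ltW m0) ?(ltW n0R)//; last by lra.
    rewrite mulrA; apply: (@le_trans _ _ (lam A * ((m - 1) / m) `^ k)).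
      by rewrite ler_wpM2r ?powR_ge0.
    rewrite -(ler_pM2r sp); apply: le_trans del.
    rewrite -mulrA ler_wpM2l// mulrC -pq; exact: rate.
  by have := Amin _ PA'; rewrite cA ltnn.
have [/existsP[S /and3P[SA cS /eqP S1]]|/existsPn noS] :=
    boolP [exists S : {set 'I_n}, [&& S \subset A, clique G S & #|S| == r.+1]].
  by exists A, S.
exfalso.
have noK (S : {set 'I_n}) : S \subset A -> clique G S -> #|S| != r.+1.
  by move=> SA cS; have := noS S; rewrite SA cS.
move: mn; rewrite leq_eqVlt => /orP[/eqP mn|mn].
  have AT : A = [set: 'I_n] by apply/eqP; rewrite eqEcard subsetT cardsT card_ord mn leqnn.
  have := @spectral_turan R r n p r0 n0 p1 G (fun S => noK S (_ : S \subset A)).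
  rewrite leNgt hG => h; suff: false by []; apply: h => S.
  by rewrite AT subsetT.
have a0 : 0 < 1 - r%:R^-1 :> R by lra.
have ub : lam A <= (1 - r%:R^-1) * m `^ (2 * q).
  have [x [x0 x1 <-]] := lam_att.
  apply: le_trans (motzkin_straus r0 x0 noK) _.
  by rewrite ler_wpM2l ?(ltW a0)// sum_le_powR.
(* The two constants differ only by [r / n ^ 2], whereas [m < n] forces [L - ln m >= 1 / n]. This
   bounds [q * theta * n] by [3 * r], against [n > L] and [q * theta * L >= 64 * r]. *)
have h := lamA_upper _ a0 ub.
have h1 : ln (1 - r%:R^-1) - ln alpha <= 3 * (r%:R / n%:R ^+ 2).
  rewrite -ln_div ?posrE//.
  have E : (1 - r%:R^-1) / alpha = 1 + (r%:R / n%:R ^+ 2) / alpha.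
    have -> : 1 - r%:R^-1 = alpha + r%:R / n%:R ^+ 2 by rewrite /alpha; ring.
    by rewrite mulrDl divff// gt_eqF.
  have d0 : 0 <= r%:R / n%:R ^+ 2 :> R by rewrite divr_ge0 ?exprn_ge0 ?ltW.
  rewrite E; apply: le_trans (le_ln1Dx _) _.
    by apply: (@lt_le_trans _ _ 0); rewrite ?ltrN10// divr_ge0// ltW.
  rewrite mulrC ler_wpM2r// -[leRHS]invrK lef_pV2 ?posrE//; lra.
have h2 : n%:R^-1 <= L - ln m.
  rewrite -ln_div ?posrE//; apply: le_trans (ln_ge_1BV _); last by rewrite divr_gt0.
  rewrite invf_div -[X in X - _](divff (lt0r_neq0 n0R)) -mulrBl.
  rewrite ler_peMl ?invr_ge0 ?(ltW n0R)// lerBrDl natr1.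
  by rewrite /m -natr1 natr1 ler_nat.
have h3 : 64 * r%:R <= q * theta * L.
  have := ler_wpM2l (ltW t0) qL_big.
  have -> : theta * (128 * r%:R ^+ 5) = 64 * r%:R * (theta * (2 * r%:R ^+ 4)) by ring.
  by rewrite tE mulr1; lra.
have qt0 : 0 <= q * theta by rewrite mulr_ge0 ?ltW.
have h4 := ler_wpM2l qt0 h2.
have h5 : q * theta * n%:R^-1 <= 3 * (r%:R / n%:R ^+ 2) by lra.
have h6 : q * theta * n%:R <= 3 * r%:R.
  have := ler_wpM2r (exprn_ge0 2 (ltW n0R)) h5.
  have -> : q * theta * n%:R^-1 * n%:R ^+ 2 = q * theta * n%:R by field; rewrite !gt_eqF.
  have -> : 3 * (r%:R / n%:R ^+ 2) * n%:R ^+ 2 = 3 * r%:R :> R by field; rewrite gt_eqF.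
  by [].
have := ler_wpM2l qt0 (ltW L_n); lra.
Qed.

End dense_subset.

(** It remains to turn the bounds on [c] and [n] into the numerical conditions of [dense_subset] and
    [dense_clique_contains_Kplus]. *)
Theorem theorem6 (R : realType) (r : nat) (p c : R) (n : nat)
    (hr : (2 <= r)%N) (hp : 1 < p)
    (hc0 : 0 < c) (hc : c <= r%:R ^- ((r + 8) * r) / 2)
    (hn : 2 * p / (c * p - c) <= ln n%:R)
    (G : sgraph 'I_n)
    (hG : pspectral_radius p (turan r n) < pspectral_radius p G) :
  contains G (Kplus r (Num.truncn (c * ln n%:R))).
Proof.
have r0 : (0 < r)%N by exact: ltnW.
have p0 : 0 < p by exact: lt_trans hp.
have rho0 : 0 < r%:R :> R by rewrite ltr0n.
set L : R := ln n%:R in hn *.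
have pB0 : 0 < p - 1 by rewrite subr_gt0.
have HL : 2 <= c * ((1 - p^-1) * L).
  have cp0 : 0 < c * p - c by rewrite -[X in _ - X]mulr1 -mulrBr mulr_gt0.
  move: hn; rewrite ler_pdivrMr// => hn'.
  rewrite -(ler_pM2r p0) (_ : c * _ * p = L * (c * p - c))//.
  by field; rewrite gt_eqF.
have cpow (N : nat) : (N <= 2 * r ^ ((r + 8) * r))%N -> c * N%:R <= 1.
  rewrite -(ler_nat R) natrM natrX => /(ler_wpM2l (ltW hc0)) /le_trans; apply.
  have pw0 : 0 < r%:R ^+ ((r + 8) * r) :> R by rewrite exprn_gt0.
  move: hc pw0; move: (r%:R ^+ _) => pw hc pw0; have := ler_wpM2r (ltW pw0) hc.
  have -> : pw^-1 / 2 * pw = 1 / 2 by field; rewrite gt_eqF.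
  by lra.
have Hc5 : 64 * c * r%:R ^+ 5 <= 1.
  rewrite mulrAC -natrX -natrM mulrC; apply: cpow.
  have : (r ^ 10 <= r ^ ((r + 8) * r))%N by apply: leq_pexp2l => //; nia.
  have : (2 ^ 5 <= r ^ 5)%N by rewrite leq_exp2r.
  by rewrite (expnD r 5 5); move: (r ^ _)%N (r ^ 5)%N => a b; nia.
(* Here [6 <= r ^ 3] gives [(6 * r ^ 3) ^ r <= r ^ (6 * r)], the factor 6 is at most [2 * r ^ 2],
   and [6 * r + 2 <= (r + 8) * r]. *)
have HK : 6 * c * ((6 * r ^ 3) ^ r)%:R <= 1.
  rewrite mulrAC -natrM mulrC; apply: cpow.
  have h1 : ((6 * r ^ 3) ^ r <= (r ^ 6) ^ r)%N.
    rewrite leq_exp2r// (expnD r 3 3) leq_mul2r; apply/orP; right.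
    by apply: (@leq_trans (2 ^ 3)) => //; rewrite leq_exp2r.
  have h2 : ((r ^ 6) ^ r * r ^ 2 <= r ^ ((r + 8) * r))%N.
    by rewrite -expnM -expnD; apply: leq_pexp2l => //; nia.
  have h3 : (2 ^ 2 <= r ^ 2)%N by rewrite leq_exp2r.
  apply: (@leq_trans (2 * ((r ^ 6) ^ r * r ^ 2))); last by rewrite leq_mul2l h2.
  rewrite -[6%N in leqLHS]/(2 * 3)%N -mulnA leq_mul2l/= mulnC.
  by apply: leq_mul => //; exact: leq_trans h3.
have [A [S [lnA deg SA cS S1]]] := dense_subset hr hp hc0 HL Hc5 hG.
have A0 : (0 < #|A|)%N by apply: leq_trans (subset_leq_card SA); rewrite S1.
have q01 : 0 < 1 - p^-1 < 1.
  have : 0 < p^-1 < 1 by rewrite invr_gt0 p0 invf_lt1.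
  by move=> /andP[? ?]; apply/andP; split; lra.
have /andP[q0 q1] := q01.
have L0 : 0 < L.
  by rewrite -(pmulr_rgt0 _ q0) -(pmulr_rgt0 _ hc0); apply: lt_le_trans HL.
have cL2 : 2 <= c * L.
  apply: le_trans HL _; rewrite ler_wpM2l ?(ltW hc0)//.
  by rewrite ler_piMl ?ltW.
set t := Num.truncn (c * L).
have t_le : t%:R <= c * L by rewrite Num.Theory.truncn_le// mulr_ge0 ?ltW.
have t2 : (2 <= t)%N by rewrite /t truncn_ge_nat// mulr_ge0 ?ltW.
apply: (dense_clique_contains_Kplus (R := R) (A := A) (S := S)) => //.
(* In logarithms, with [ln 4 <= 3], the required size is at most [3 * (6 * r ^ 3) ^ r * c * L],
   which [HK] bounds by [L / 2]. *)
rewrite -(ler_nat R) natrX -ler_ln ?posrE ?exprn_gt0 ?ltr0n//.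
rewrite lnXn ?ltr0n// -[_ *+ (_ * t)]mulr_natr natrM; apply: le_trans lnA.
have ln4 : ln 4 <= 3 :> R.
  by have := @le_ln1Dx R 3; rewrite (_ : 1 + 3 = 4); [apply; lra | ring].
have K0 : 0 <= ((6 * r ^ 3) ^ r)%:R :> R by [].
have h1 := ler_wpM2l K0 t_le.
have Kt0 : 0 <= ((6 * r ^ 3) ^ r)%:R * t%:R :> R by rewrite mulr_ge0.
have h2 := ler_wpM2r Kt0 ln4.
have h3 := ler_wpM2r (ltW L0) HK.
rewrite -/L; move: h1 h2 h3; move: (_ ^ r)%:R (t%:R) => K T; lra.
Qed.
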